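(* Assume the narrow class number of $F$ is $1$. Let $k>2$ be even, $\mathfrak{n}$ a nonzero integral ideal, $\mathfrak{c}$ a fractional ideal with totally positive generator $q$, and $\mu\in\mathfrak{c}^+$. (1) Let $\alpha\in\mathcal{O}^+$ be such that $(\alpha)$ is coprime to the ideal $\mu q^{-1}\mathfrak{n}$. If $P_\mu(z;k,\mathfrak{c},\mathfrak{n})\equiv0$, then $P_{\mu\alpha}(z;k,\mathfrak{c},\mathfrak{n})\equiv0$. (2) Let $p$ be a totally positive prime element such that $(p)$ is coprime to $\mu q^{-1}\mathfrak{n}$, and let $m$ be a positive integer. If $P_\mu(z;k,\mathfrak{c},\mathfrak{n})\not\equiv0$, then either $P_{\mu p^m}(z;k,\mathfrak{c},\mathfrak{n})\not\equiv0$, or both $P_{\mu p^{m-1}}(z;k,\mathfrak{c},\mathfrak{n})\not\equiv0$ and $P_{\mu p^{m+1}}(z;k,\mathfrak{c},\mathfrak{n})\not\equiv0$.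
   Context: $F$ is a totally real number field of degree $n>1$ with ring of integers $\mathcal{O}$, different $\mathfrak{d}$, real embeddings $\sigma_i$, $a_i=\sigma_i(a)$; $S^+$ is the set of totally positive elements of $S\subset F$, $\mathcal{O}^{\times+}$ the totally positive units, $N$ the norm. A prime element is a generator of a nonzero prime ideal. For a fractional ideal $\mathfrak{c}$ and nonzero integral ideal $\mathfrak{n}$, $\Gamma=\Gamma_0(\mathfrak{c},\mathfrak{n})=\{\begin{pmatrix}a&b\\c&d\end{pmatrix}: a,d\in\mathcal{O}, b\in(\mathfrak{c}\mathfrak{d})^{-1}, c\in\mathfrak{c}\mathfrak{n}\mathfrak{d}, ad-bc\in\mathcal{O}^{\times+}\}$ acts componentwise on $\mathbb{H}^n$. With $N(cz+d)^k=\prod_i(c_iz_i+d_i)^k$ and $e(\mu w)=\exp(2\pi i\sum_i\mu_iw_i)$, for even $k>2$ and $\mu\in\mathfrak{c}^+$ the Hilbert Poincaré series is $P_\mu(z;k,\mathfrak{c},\mathfrak{n})=\sum_{\gamma\in Z(\Gamma)N(\Gamma)\backslash\Gamma}N(cz+d)^{-k}e(\mu\gamma z)$ with $Z(\Gamma)=\{\varepsilon I:\varepsilon\in\mathcal{O}^\times\}$, $N(\Gamma)=\{\begin{pmatrix}1&b\\0&1\end{pmatrix}:b\in(\mathfrak{c}\mathfrak{d})^{-1}\}$. *)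

(* Defs.v *)
(* Hilbert Poincare series over a
   totally real number field F (a degree-n extension of Q with n distinct
   real embeddings sigma_i).  Reals: Stdlib's R, seen as a realType. *)
From HB Require Import structures.
From mathcomp Require Import all_boot all_order all_algebra all_field.
From mathcomp Require Import all_classical all_reals all_analysis.
From mathcomp Require Import complex.
From mathcomp Require Import Rstruct.

Set Implicit Arguments.
Unset Strict Implicit.
Unset Printing Implicit Defensive.

Import Order.TTheory GRing.Theory Num.Theory.
Local Open Scope ring_scope.
Local Open Scope classical_set_scope.

Notation RR := Rdefinitions.R.

Section HilbertPoincare.

Variables (n : nat) (F : fieldExtType rat) (sigma : 'I_n -> {rmorphism F -> RR}).

Definition OK : set F :=
  [set x | exists p : {poly int}, p \is monic /\
           root (map_poly (fun z : int => z%:~R : F) p) x].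

Definition totpos (x : F) : Prop := forall i, 0 < sigma i x.

Definition unitO (x : F) : Prop := OK x /\ x != 0 /\ OK x^-1.
Definition unitO_pos (x : F) : Prop := unitO x /\ totpos x.

Definition trF (x : F) : RR := \sum_(i < n) sigma i x.

Definition frac_ideal (I : set F) : Prop :=
  [/\ I 0,
      (forall x y, I x -> I y -> I (x + y)),
      (forall a x, OK a -> I x -> I (a * x)),
      (exists x, I x /\ x != 0) &
      (exists d, OK d /\ d != 0 /\ (forall x, I x -> OK (d * x)))].

Definition int_ideal (I : set F) : Prop := frac_ideal I /\ I `<=` OK.

Definition principal (x : F) : set F := [set x * y | y in OK].

Definition ideal_mul (I J : set F) : set F :=
  [set x | exists (m : nat) (a b : 'I_m -> F),
     (forall j, I (a j)) /\ (forall j, J (b j)) /\ x = \sum_(j < m) a j * b j].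

Definition ideal_add (I J : set F) : set F := [set a + b | a in I & b in J].

Definition ideal_inv (I : set F) : set F := [set x | forall y, I y -> OK (x * y)].

Definition codifferent : set F :=
  [set x | forall y, OK y -> exists z : int, trF (x * y) = z%:~R].
Definition different : set F := ideal_inv codifferent.

Definition coprime_ideals (I J : set F) : Prop := ideal_add I J = OK.

Definition prime_elt (p : F) : Prop :=
  [/\ OK p, p != 0, principal p != OK &
      forall x y, OK x -> OK y -> principal p (x * y) ->
        principal p x \/ principal p y].

Definition narrow_class_number_one : Prop :=
  forall I, frac_ideal I -> exists x, totpos x /\ I = principal x.

Definition i0 : 'I_2 := @Ordinal 2 0 isT.
Definition i1 : 'I_2 := @Ordinal 2 1 isT.
Definition ma (g : 'M[F]_2) := g i0 i0.
Definition mb (g : 'M[F]_2) := g i0 i1.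
Definition mc (g : 'M[F]_2) := g i1 i0.
Definition md (g : 'M[F]_2) := g i1 i1.

Definition Gamma0 (c nn : set F) : set 'M[F]_2 :=
  [set g | [/\ OK (ma g), OK (md g),
              ideal_inv (ideal_mul c different) (mb g),
              ideal_mul (ideal_mul c nn) different (mc g) &
              unitO_pos (ma g * md g - mb g * mc g)]].

Definition transl (b : F) : 'M[F]_2 := \matrix_(i, j)
  (if i == j then 1 else if (i == i0) && (j == i1) then b else 0).

Definition ZNcoset (c : set F) (g : 'M[F]_2) : set 'M[F]_2 :=
  [set (e%:M *m transl b) *m g | e in unitO & b in ideal_inv (ideal_mul c different)].

Definition ZN_cosets (c nn : set F) : set (set 'M[F]_2) :=
  [set S | exists2 g, Gamma0 c nn g & S = ZNcoset c g].

(* absolutely convergent complex sum over a set (via positive and negative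
   parts of real and imaginary parts) *)
Definition csum (T : choiceType) (D : set T) (f : T -> RR[i]) : RR[i] :=
  let s (g : T -> RR) :=
    fine (esum D (fun x => (Num.max (g x) 0)%:E)) -
    fine (esum D (fun x => (Num.max (- g x) 0)%:E)) in
  Complex (s (fun x => complex.Re (f x))) (s (fun x => complex.Im (f x))).

Definition cexp (w : RR[i]) : RR[i] :=
  Complex (expR (complex.Re w) * cos (complex.Im w))
          (expR (complex.Re w) * sin (complex.Im w)).

Definition cemb (i : 'I_n) (x : F) : RR[i] := Complex (sigma i x) 0.

Definition poincare_term (k : nat) (mu : F) (z : 'I_n -> RR[i]) (g : 'M[F]_2)
  : RR[i] :=
  (\prod_(i < n) (cemb i (mc g) * z i + cemb i (md g))) ^- k *
  cexp (Complex 0 (2 * pi) *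
        \sum_(i < n) cemb i mu *
          ((cemb i (ma g) * z i + cemb i (mb g)) /
           (cemb i (mc g) * z i + cemb i (md g)))).

Definition poincare (k : nat) (c nn : set F) (mu : F) (z : 'I_n -> RR[i])
  : RR[i] :=
  csum (ZN_cosets c nn) (fun S => poincare_term k mu z (xget 0 S)).

Definition upper_half_n (z : 'I_n -> RR[i]) : Prop := forall i, 0 < complex.Im (z i).

Definition poincare_zero (k : nat) (c nn : set F) (mu : F) : Prop :=
  forall z, upper_half_n z -> poincare k c nn mu z = 0.

End HilbertPoincare.

(* Main.v *)
(* Let M_al be the set of matrices (a b; c d) with a, d in O, b and c in the ideals
   of the off-diagonal entries of Gamma, and determinant al times a totally positive
   unit.  Summing N(cz+d)^-k e(mu g z) over ZN\M_al along the Gamma-orbits gives a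
   combination of values of P_mu, hence 0 when P_mu = 0.  Summing instead according
   to the ideal generated by the bottom row: the unit ideal contributes P_(mu al);
   an ideal (d) with d not dividing mu/q contributes 0, because a unipotent
   translation preserves that part and multiplies its terms by a constant different
   from 1.  For al = p prime dividing mu/q the remaining part is a nonzero multiple of
   P_(mu/p), and the resulting three-term relation gives (2) by descent.

   Absolute convergence: modulo squares of units the determinants are bounded, and
   |w|^-k exp(-A/|w|^2), with w = cz+d, is O(1/((1+c^2)(1+d^2))) for k >= 4, so that
   everything reduces to the sum over x in O of prod_i 1/(1+x_i^2). *)
Require Import Defs.
From HB Require Import structures.
From mathcomp Require Import all_boot all_order all_algebra all_field.
From mathcomp Require Import all_classical all_reals all_analysis.
From mathcomp Require Import complex Rstruct.
From mathcomp Require Import ring lra zify.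
Import Order.TTheory GRing.Theory Num.Theory.
Local Open Scope ring_scope.
Local Open Scope classical_set_scope.
Set Implicit Arguments.
Unset Strict Implicit.
Unset Printing Implicit Defensive.

(** * Algebraic integers, traces and norms *)

(** Since the level and the codifferent have totally positive generators, membership in the ideals
    of the matrix entries becomes integrality of a rescaled entry, and matrices can be handled by
    field identities. The series is defined from sums of positive and negative parts, with value 0
    where such a sum diverges, so no regrouping is legitimate before absolute convergence is known;
    it is proved for ZN\M_al for each totally positive al in O. Regrouping into possibly infinitely
    many groups is then needed only when every group sums to 0, which requires nothing about
    iterated sums: positive and negative parts agree on each group. Finiteness statements (totally
    positive units modulo squares, residues modulo al) appear as the existence of representatives
    with bounded conjugates. Such elements of O are not counted: each costs only a constant factor
    when its weight prod_i 1/(1+x_i^2) is inserted into the majorant. Cosets are sets of matrices,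
    and comparisons are bijections between sets of cosets, so no list of representatives is ever
    needed. *)

Lemma sigma_alg (n : nat) (F : fieldExtType rat) (sigma : 'I_n -> {rmorphism F -> RR}) i (a : rat) (x : F) :
  sigma i (a *: x) = ratr a * sigma i x.
Proof.
rewrite -[in LHS](mul1r x) scalerAl rmorphM; congr (_ * _).
exact: (fmorph_eq_rat (sigma i \o in_alg F)).
Qed.

Section Integers.
Context (F : fieldExtType rat).

Lemma OK_integral (x : F) : OK x <-> integralOver (intr : int -> F) x.
Proof. by split=> [[p [? ?]]|[p ? ?]]; exists p. Qed.

Lemma OK_int (z : int) : OK (z%:~R : F).
Proof. exact/OK_integral/integral_id. Qed.
Lemma OK0 : OK (0 : F). Proof. exact: (OK_int 0). Qed.
Lemma OK1 : OK (1 : F). Proof. exact: (OK_int 1). Qed.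
Lemma OKN (x : F) : OK x -> OK (- x).
Proof. by rewrite !OK_integral; apply: integral_opp. Qed.
Lemma OKD (x y : F) : OK x -> OK y -> OK (x + y).
Proof. by rewrite !OK_integral; apply: integral_add. Qed.
Lemma OKB (x y : F) : OK x -> OK y -> OK (x - y).
Proof. by rewrite !OK_integral; apply: integral_sub. Qed.
Lemma OKM (x y : F) : OK x -> OK y -> OK (x * y).
Proof. by rewrite !OK_integral; apply: integral_mul. Qed.
Lemma OK_sum (I : Type) (r : seq I) (P : pred I) (f : I -> F) :
  (forall i, P i -> OK (f i)) -> OK (\sum_(i <- r | P i) f i).
Proof. by move=> h; elim/big_ind: _ => //; [exact: OK0 | exact: OKD]. Qed.

Lemma intr_eq0_ext (z : int) : ((z%:~R : F) == 0) = (z == 0).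
Proof. by rewrite -scaler_int scaler_eq0 oner_eq0 orbF intr_eq0. Qed.

(** If an integer polynomial of degree m with leading coefficient l and coefficients q_i has root x,
    then l x is a root of the monic integer polynomial X^m + sum_(i<m) l^(m-1-i) q_i X^i, which is
    [r] below. *)
Lemma OK_scale (x : F) : exists2 d : int, d != 0 & OK (d%:~R * x).
Proof.
have [p p0 px] : algebraicOver (in_alg F) x.
  have /polyOver1P[p Dp] := minPolyOver 1 x.
  exists p; last by rewrite -Dp root_minPoly.
  by apply: contraTneq (monic_minPoly 1 x) => E; rewrite Dp E rmorph0 monicE lead_coef0 eq_sym oner_eq0.
have [q [a a0 Dp]] := rat_poly_scale p.
have q0 : q != 0 by apply: contraNneq p0 => E; rewrite Dp E rmorph0 scaler0.
have qx : root (map_poly (intr : int -> F) q) x.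
  move: px; rewrite Dp map_polyZ -map_poly_comp /= rootZ; last first.
    by rewrite scaler_eq0 oner_eq0 orbF invr_eq0 intr_eq0.
  by apply: etrans; congr root; apply: eq_map_poly => z /=; rewrite scaler_int.
exists (lead_coef q); first by rewrite lead_coef_eq0.
apply/OK_integral.
pose m := (size q).-1; have Dm : size q = m.+1 by rewrite polySpred.
pose r : {poly F} := \poly_(i < m.+1)
   (if i == m then 1 else ((lead_coef q) ^+ (m.-1 - i) * q`_i)%:~R).
have [m0|m0] := posnP m.
  move: qx; rewrite /root (size1_polyC (p := q)) ?Dm ?m0 // map_polyC hornerC /= intr_eq0_ext => E.
  by case/negP: q0; rewrite (size1_polyC (p := q)) ?Dm ?m0 // polyC_eq0.
apply: (@integral_root_monic _ _ _ _ r).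
- rewrite monicE lead_coefE /r size_poly_eq ?eqxx ?oner_eq0 //=.
  by rewrite coef_poly ltnSn eqxx.
- apply/rootP; rewrite horner_poly big_ord_recr /= eqxx mul1r.
  have /rootP := qx; rewrite horner_coef size_map_poly_id0; last by rewrite intr_eq0_ext lead_coef_eq0.
  rewrite Dm big_ord_recr /= => E.
  transitivity ((lead_coef q)%:~R ^+ m.-1 * (\sum_(i < m) (map_poly intr q)`_i * x ^+ i + (map_poly intr q)`_m * x ^+ m) : F); last by rewrite E mulr0.
  rewrite mulrDr; congr (_ + _).
    rewrite mulr_sumr; apply: eq_bigr => i _; rewrite coef_map ifN ?neq_ltn ?ltn_ord //=.
    rewrite rmorphM rmorphXn exprMn mulrACA; congr (_ * _).
    by rewrite -exprD; congr (_ ^+ _); rewrite subnK // -ltnS prednK.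
  have -> : (map_poly intr q)`_m = (lead_coef q)%:~R :> F by rewrite coef_map lead_coefE Dm.
  by rewrite mulrA -exprSr prednK // exprMn.
- apply/integral_poly => i; rewrite coef_poly; case: ifP => _; last exact/OK_integral/OK0.
  case: ifP => _; apply/OK_integral; [exact: OK1 | exact: OK_int].
Qed.

End Integers.

(** The annihilating polynomial has integer coefficients, so it can be moved to [algC], where a
    rational algebraic integer is known to be an integer. *)
Lemma rat_integral_int (K : numFieldType) (r : rat) :
  integralOver (intr : int -> K) (ratr r) -> exists z : int, r = z%:~R.
Proof.
case=> p pm pr.
have {}pr : root (map_poly (intr : int -> rat) p) r.
  move: pr; rewrite (_ : map_poly _ p = map_poly ratr (map_poly (intr : int -> rat) p)) ?fmorph_root //.
  by rewrite -map_poly_comp; apply: eq_map_poly => z /=; rewrite ratr_int.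
have /Cint_rat_Aint : ratr r \in Crat by apply: Crat_rat.
have Ai : (ratr r : algC) \in Aint.
  apply: (@root_monic_Aint (map_poly intr p)).
  - rewrite (_ : map_poly _ p = map_poly ratr (map_poly (intr : int -> rat) p)) ?fmorph_root //.
    by rewrite -map_poly_comp; apply: eq_map_poly => z /=; rewrite ratr_int.
  - exact: monic_map.
  - by apply/polyOverP => i; rewrite coef_map /= Num.Theory.intr_int.
move/(_ Ai)/intrP => [z Dz]; exists z.
apply: (fmorph_inj (ratr : {rmorphism rat -> algC})); exact: etrans Dz (esym (ratr_int _ z)).
Qed.
(** Injectivity of [sigma] is about bundled morphisms, while separation arguments only give equality
    of values. *)
Lemma rmorph_ext (A B : pzSemiRingType) (f g : {rmorphism A -> B}) : f =1 g -> f = g.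
Proof.
case: f g => f [[fa] [fm]] [g [[ga] [gm]]] /= /funext E.
move: ga gm; case: _ / E => ga gm.
by rewrite (Prop_irrelevance fa ga) (Prop_irrelevance fm gm).
Qed.

Section Traces.
Variables (n : nat) (F : fieldExtType rat) (sigma : 'I_n -> {rmorphism F -> RR}).
Hypotheses (n_gt1 : (1 < n)%N) (dimF : \dim {:F} = n) (sig_inj : injective sigma).

Definition nrF (x : F) : RR := \prod_(i < n) sigma i x.

(** In characteristic 0 the field is generated by one element [th], and an embedding is determined
    by its value there. *)
Lemma primitive_elt_separates : exists th : F, injective (fun i => sigma i th).
Proof.
pose th := separable_generator 1%VS {:F}; exists th => i j /= E.
have sep : separable 1%VS {:F}.
  apply/separableP => y _; apply: pcharf0_separable => p; rewrite inE.
  by apply/negP => /andP[pp]; rewrite pmulrn intr_eq0_ext => /eqP[p0]; rewrite p0 in pp.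
have gen := eq_adjoin_separable_generator sep (sub1v _).
apply/sig_inj/rmorph_ext => x; have : x \in <<1; th>>%VS by rewrite -gen memvf.
case/Fadjoin_polyP => p /polyOver1P[q ->] ->.
rewrite !horner_coef !rmorph_sum; apply: eq_bigr => k _.
by rewrite !rmorphM !rmorphXn E coef_map /= !sigma_alg !rmorph1.
Qed.

Let e := vbasis {:F}.
Let eE x : x = \sum_(k < \dim {:F}) coord e k x *: e`_k.
Proof. exact: coord_vbasis (memvf x). Qed.

Definition basis_mx : 'M[RR]_(\dim {:F}, n) := \matrix_(k, i) sigma i e`_k.

(** Linear independence of the embeddings: a relation among them, evaluated at the powers of a
    separating element, is killed by an invertible Vandermonde matrix. *)
Lemma basis_mx_free : row_free basis_mx^T.
Proof.
rewrite -kermx_eq0; apply/eqP/row_matrixP => j; rewrite row0.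
set a := row _ _; have aV : a *m basis_mx^T = 0 by rewrite -row_mul mulmx_ker row0.
have ax x : \sum_i a 0 i * sigma i x = 0.
  transitivity (\sum_(k < \dim {:F}) ratr (coord e k x) * (a *m basis_mx^T) 0 k); last first.
    by rewrite aV; apply: big1 => k _; rewrite mxE mulr0.
  under [RHS]eq_bigr => k _ do rewrite mxE mulr_sumr.
  rewrite exchange_big /=; apply: eq_bigr => i _.
  rewrite [in LHS](eE x) rmorph_sum mulr_sumr; apply: eq_bigr => k _.
  by rewrite sigma_alg !mxE mulrCA.
have [th th_inj] := primitive_elt_separates.
pose W := @Vandermonde RR n n (\row_i sigma i th).
have Wu : W \in unitmx.
  rewrite unitmxE det_Vandermonde unitfE; apply/prodf_neq0 => i _.
  apply/prodf_neq0 => k ik; rewrite !mxE subr_eq0; apply: contraTneq ik => /th_inj ->.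
  by rewrite ltnn.
have aW : a *m W^T = 0.
  apply/rowP => k; rewrite !mxE -[RHS](ax (th ^+ k)); apply: eq_bigr => i _.
  by rewrite !mxE rmorphXn.
by rewrite -[a](@mulmxK _ _ _ W^T) ?unitmx_tr // aW mul0mx.
Qed.

Definition mult_mx (x : F) : 'M[rat]_(\dim {:F}) := \matrix_(j, k) coord e k (x * e`_j).

Lemma mult_mxE x : basis_mx *m diag_mx (\row_i sigma i x) = map_mx ratr (mult_mx x) *m basis_mx.
Proof.
apply/matrixP => j i; rewrite mul_mx_diag !mxE mulrC -rmorphM [in LHS](eE (x * _)).
by rewrite rmorph_sum; apply: eq_bigr => k _; rewrite sigma_alg !mxE.
Qed.

(** [basis_mx] conjugates the rational matrix of multiplication by x to the diagonal matrix of the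
    conjugates, so trace and norm are rational; integrality then makes them integers. *)
Lemma tr_nr_mult_mx x : trF sigma x = ratr (\tr (mult_mx x)) /\ nrF x = ratr (\det (mult_mx x)).
Proof.
have := mult_mxE x; have := basis_mx_free; move: basis_mx (mult_mx x) => V M.
(* Identifying [n] with [\dim {:F}] makes [V] square, so that free rows mean invertibility. *)
case: _ / (esym dimF) V M => V M; rewrite row_free_unit unitmx_tr => Vu E.
have : diag_mx (\row_i sigma i x) = invmx V *m (map_mx ratr M *m V) by rewrite -E mulKmx.
move=> D; split.
  rewrite -trace_map_mx -[map_mx _ M](mulmxK Vu) mxtrace_mulC -D mxtrace_diag.
  by apply: eq_bigr => i _; rewrite mxE.
rewrite -det_map_mx; transitivity (\det (diag_mx (\row_i sigma i x))).
  by rewrite det_diag; apply: eq_bigr => i _; rewrite mxE.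
by rewrite D !det_mulmx det_inv mulrCA mulVr ?mulr1 -?unitmxE.
Qed.

Lemma sigma_integral i x : OK x -> integralOver (intr : int -> RR) (sigma i x).
Proof.
case=> p [pm px]; exists p => //; move: px => /(rmorph_root (sigma i)).
rewrite -map_poly_comp; apply: etrans; congr root; apply: eq_map_poly => z /=.
by rewrite rmorph_int.
Qed.

Lemma trF_int x : OK x -> exists z : int, trF sigma x = z%:~R.
Proof.
move=> Ox; have [E _] := tr_nr_mult_mx x.
have [|z Dz] := @rat_integral_int RR (\tr (mult_mx x)); last by exists z; rewrite E Dz ratr_int.
rewrite -E /trF; apply: (big_ind (integralOver (intr : int -> RR))).
- exact: (@integral_id int RR intr 0).
- by move=> u v; apply: integral_add.
- by move=> i _; apply: sigma_integral.
Qed.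

Lemma nrF_int x : OK x -> exists z : int, nrF x = z%:~R.
Proof.
move=> Ox; have [_ E] := tr_nr_mult_mx x.
have [|z Dz] := @rat_integral_int RR (\det (mult_mx x)); last by exists z; rewrite E Dz ratr_int.
rewrite -E /nrF; apply: (big_ind (integralOver (intr : int -> RR))).
- exact: (@integral_id int RR intr 1).
- by move=> u v; apply: integral_mul.
- by move=> i _; apply: sigma_integral.
Qed.

Lemma nrF_unit x : unitO x -> nrF x ^+ 2 = 1.
Proof.
move=> [Ox [x0 Ox']]; have [z Dz] := nrF_int Ox; have [w Dw] := nrF_int Ox'.
have zw : z * w = 1.
  apply: (@intr_inj RR); rewrite intrM -Dz -Dw -big_split /=; apply: big1 => i _.
  by rewrite -rmorphM divff ?rmorph1.
have /eqP : (`|z| * `|w|)%N = 1%N by rewrite -abszM zw.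
rewrite muln_eq1 => /andP[/eqP z1 _].
by rewrite Dz -rmorphXn -[z ^+ 2]real_normK ?num_real // -abszE z1 expr1n.
Qed.

(** Tr(x^2) is a non-negative integer, bounded by n * n^-2 < 1, hence 0, and it is a sum of squares.
    This is the discreteness of O behind all summability. *)
Lemma OK_small_eq0 x : OK x -> (forall i, `|sigma i x| < n%:R^-1) -> x = 0.
Proof.
move=> Ox small; have n0 : 0 < n%:R :> RR by rewrite ltr0n ltnW.
have [z Dz] := trF_int (OKM Ox Ox).
have sq i : sigma i (x * x) <= n%:R^-1 ^+ 2.
  by rewrite rmorphM -expr2 -real_normK ?num_real // lerXn2r ?nnegrE ?normr_ge0 ?invr_ge0 ?ltW.
have z1 : trF sigma (x * x) < 1.
  apply: (@le_lt_trans _ _ n%:R^-1); last by rewrite invf_lt1 // ltr1n.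
  rewrite /trF (le_trans (ler_sum _ (fun i _ => sq i))) // sumr_const card_ord.
  by rewrite -[leLHS]mulr_natr expr2 -mulrA mulVf ?mulr1 ?gt_eqF.
have pos i : 0 <= sigma i (x * x) by rewrite rmorphM -expr2 sqr_ge0.
have z0 : trF sigma (x * x) = 0.
  have : 0 <= trF sigma (x * x) by apply: sumr_ge0 => i _.
  by move: z1; rewrite Dz ler0z ltrz1 => /= ? ?; apply/eqP; rewrite intr_eq0; lia.
have /eqP := @psumr_eq0P _ _ predT _ (fun i _ => pos i) z0 (Ordinal (ltnW n_gt1)) isT.
by rewrite fmorph_eq0 mulf_eq0 orbb => /eqP.
Qed.

End Traces.
(** * Principal ideals and the codifferent *)

Section Ideals.
Context (F : fieldExtType rat).
Implicit Types (x y : F) (I J : set F).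

Lemma principalP x z : x != 0 -> principal x z <-> OK (z / x).
Proof.
move=> x0; split=> [[y Oy <-]|Oz]; first by rewrite mulrC mulKf.
by exists (z / x) => //; rewrite mulrC divfK.
Qed.

Lemma principal_inv x : x != 0 -> ideal_inv (principal x) = principal x^-1.
Proof.
move=> x0; apply/seteqP; split=> z.
  move=> /(_ x) h; rewrite principalP ?invr_eq0 // invrK; apply: h.
  by exists 1; [exact: OK1 | rewrite mulr1].
rewrite principalP ?invr_eq0 // invrK => Oz _ [y Oy <-].
by rewrite mulrA; apply: OKM.
Qed.

Lemma principal_mul x y : ideal_mul (principal x) (principal y) = principal (x * y).
Proof.
apply/seteqP; split=> z.
  move=> [m [a [b [ha [hb ->]]]]].
  have [a' Ha] := @choice _ _ (fun j y => OK y /\ x * y = a j) (fun j => let: ex_intro2 u h1 h2 := ha j in ex_intro _ u (conj h1 h2)).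
  have [b' Hb] := @choice _ _ (fun j z => OK z /\ y * z = b j) (fun j => let: ex_intro2 u h1 h2 := hb j in ex_intro _ u (conj h1 h2)).
  exists (\sum_j a' j * b' j).
    by apply: OK_sum => j _; apply: OKM; [case: (Ha j) | case: (Hb j)].
  rewrite mulr_sumr; apply: eq_bigr => j _.
  by case: (Ha j) (Hb j) => _ <- [_ <-]; rewrite mulrACA.
case=> w Ow <-; exists 1%N, (fun=> x), (fun=> y * w).
split; first by move=> _; exists 1; [exact: OK1 | rewrite mulr1].
split; first by move=> _; exists w.
by rewrite big_ord1 mulrA.
Qed.

End Ideals.

Section Codifferent.
Variables (n : nat) (F : fieldExtType rat) (sigma : 'I_n -> {rmorphism F -> RR}).
Hypotheses (n_gt1 : (1 < n)%N) (dimF : \dim {:F} = n) (sig_inj : injective sigma).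

Lemma trFD x y : trF sigma (x + y) = trF sigma x + trF sigma y.
Proof. by rewrite -big_split; apply: eq_bigr => i _; rewrite rmorphD. Qed.

Lemma trFZ (a : rat) x : trF sigma (a *: x) = ratr a * trF sigma x.
Proof. by rewrite mulr_sumr; apply: eq_bigr => i _; rewrite sigma_alg. Qed.

Lemma trF_sum (I : Type) (r : seq I) (P : pred I) (f : I -> F) :
  trF sigma (\sum_(i <- r | P i) f i) = \sum_(i <- r | P i) trF sigma (f i).
Proof.
apply: (big_morph (trF sigma) trFD).
by apply: big1 => i _; rewrite rmorph0.
Qed.

Lemma trF_sqr_eq0 x : trF sigma (x * x) = 0 -> x = 0.
Proof.
have pos i : 0 <= sigma i (x * x) by rewrite rmorphM -expr2 sqr_ge0.
move=> z0.
have /eqP := @psumr_eq0P _ _ predT _ (fun i _ => pos i) z0 (Ordinal (ltnW n_gt1)) isT.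
by rewrite fmorph_eq0 mulf_eq0 orbb => /eqP.
Qed.

(** The point is a common denominator. Let T be the integer Gram matrix of the trace form on an
    integral basis [f] of F; det T is nonzero because Tr(x^2) = 0 forces x = 0. If x lies in the
    codifferent, its coordinates times T are integers, so by the adjugate det T times the
    coordinates are integers. *)
Lemma codifferent_frac_ideal : frac_ideal (codifferent sigma).
Proof.
have trI := trF_int dimF sig_inj.
split.
- by move=> y _; exists 0; rewrite mul0r; apply: big1 => i _; rewrite rmorph0.
- move=> x y hx hy z Oz; have [a Da] := hx z Oz; have [b Db] := hy z Oz.
  by exists (a + b); rewrite mulrDl trFD Da Db rmorphD.
- by move=> a x Oa hx z Oz; rewrite mulrAC mulrC; apply: hx; apply: OKM.
- by exists 1; split; [move=> y Oy; rewrite mul1r; apply: trI | exact: oner_neq0].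
pose m := \dim {:F}; pose e := vbasis {:F}.
have /choice [d Hd] : forall k : 'I_m, exists d : int, d != 0 /\ OK (d%:~R * e`_k).
  by move=> k; have [d ? ?] := OK_scale e`_k; exists d.
pose f k : F := (d k)%:~R * e`_k.
have Of k : OK (f k) by case: (Hd k).
pose u k : rat := (d k)%:~R.
have fE k : f k = u k *: e`_k by rewrite /f scaler_int mulrzl.
have u0 k : u k != 0 by rewrite intr_eq0; case: (Hd k).
have span x : exists X : 'rV[rat]_m, x = \sum_k X 0 k *: f k.
  exists (\row_k (coord e k x / u k)); rewrite {1}(coord_vbasis (memvf x)).
  by apply: eq_bigr => k _; rewrite mxE fE scalerA divfK.
have free (X : 'rV[rat]_m) : \sum_k X 0 k *: f k = 0 -> X = 0.
  move=> E; apply/rowP => k; rewrite mxE.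
  have /freeP/(_ (fun k => X 0 k * u k)) := basis_free (vbasisP {:F}).
  have E' : \sum_(j < m) (X 0 j * u j) *: e`_j = 0.
    by rewrite -[RHS]E; apply: eq_bigr => j _; rewrite fE scalerA.
  by move=> /(_ E' k) /eqP; rewrite mulf_eq0 (negPf (u0 k)) orbF => /eqP.
have /choice [t Ht] : forall jk : 'I_m * 'I_m, exists z : int, trF sigma (f jk.1 * f jk.2) = z%:~R.
  by move=> jk; apply/trI/OKM.
pose T : 'M[int]_m := \matrix_(j, k) t (j, k).
have XT (X : 'rV[rat]_m) j :
    trF sigma ((\sum_k X 0 k *: f k) * f j) = ratr ((X *m map_mx intr T) 0 j).
  rewrite mulr_suml trF_sum !mxE rmorph_sum; apply: eq_bigr => k _.
  rewrite -scalerAl trFZ rmorphM !mxE (Ht (k, j)); congr (_ * _); exact: (esym (ratr_int _ _)).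
have T0 : \det T != 0.
  rewrite -(intr_eq0 rat) -det_map_mx; apply/negP => /det0P [X X0 E].
  case/negP: X0; apply/eqP/free/trF_sqr_eq0.
  rewrite mulr_sumr trF_sum; apply: big1 => j _.
  by rewrite -scalerAr trFZ XT E mxE rmorph0 mulr0.
exists (\det T)%:~R; split; first exact: OK_int.
split; first by rewrite intr_eq0_ext.
move=> x cx; have [X Dx] := span x.
have /choice [z Hz] : forall j, exists z : int, trF sigma (x * f j) = z%:~R.
  by move=> j; apply: cx.
have ZE : X *m map_mx intr T = map_mx intr (\row_j z j).
  apply/rowP => j; apply: (fmorph_inj (ratr : {rmorphism rat -> RR})).
  by apply: etrans (esym (XT X j)) _; rewrite -Dx Hz !mxE /= ratr_int.
have XE : (\det T)%:~R *: X = map_mx intr ((\row_j z j) *m \adj T).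
  by rewrite map_mxM -ZE -mulmxA -map_mxM mul_mx_adj map_scalar_mx mul_mx_scalar.
rewrite Dx mulr_sumr; apply: OK_sum => k _.
rewrite -scalerAr mulrzl -scaler_int scalerA mulrC.
have -> : (\det T)%:~R * X 0 k = (((\row_j z j) *m \adj T) 0 k)%:~R :> rat.
  by move/rowP: XE => /(_ k); rewrite !mxE.
by rewrite scaler_int -mulrzl; apply: OKM => //; apply: OK_int.
Qed.

End Codifferent.
(** * Lattice sums *)

Section Sums.
Local Open Scope ereal_scope.

Lemma esumZl (T : choiceType) (D : set T) (c : RR) (f : T -> \bar RR) :
  (0 <= c)%R -> (forall x, D x -> 0 <= f x) ->
  \esum_(x in D) (c%:E * f x) = c%:E * \esum_(x in D) f x.
Proof.
have le_scale (c' : RR) (g : T -> \bar RR) : (0 <= c')%R -> (forall x, D x -> 0 <= g x) ->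
    \esum_(x in D) (c'%:E * g x) <= c'%:E * \esum_(x in D) g x.
  move=> c0 g0; apply: ge_ereal_sup => _ [X [finX XD] <-].
  rewrite fsbig_finite //= big_seq -ge0_sume_distrr; last first.
    by move=> i; rewrite in_fset_set // inE => /XD /g0.
  rewrite -big_seq -fsbig_finite //; apply: lee_wpmul2l; first by rewrite lee_fin.
  by apply: ereal_sup_ubound; exists X.
move=> c0 f0; apply/eqP; rewrite eq_le le_scale //=.
have [->|cn0] := eqVneq c 0%R.
  by rewrite mul0e; apply: esum_ge0 => x _; rewrite mul0e.
have cf0 x : D x -> 0 <= c%:E * f x by move=> Dx; rewrite mule_ge0 ?lee_fin // f0.
have := le_scale c^-1%R _ _ cf0; rewrite invr_ge0 => /(_ c0) h.
rewrite -lee_pdivlMl; last by rewrite lt_neqAle eq_sym cn0.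
rewrite (le_trans _ h) // le_esum // => x Dx.
by rewrite muleA -EFinM mulVf // mul1e.
Qed.

Lemma esum_sub (T : choiceType) (A B : set T) (f : T -> \bar RR) :
  A `<=` B -> \esum_(x in A) f x <= \esum_(x in B) f x.
Proof.
move=> AB; apply: ge_ereal_sup => _ [X [finX XA] <-]; apply: ereal_sup_ubound.
by exists X => //; split=> // x /XA /AB.
Qed.

Lemma esum_inj_le (T U : choiceType) (A : set T) (B : set U) (h : T -> U) (f : U -> \bar RR) :
  {in A &, injective h} -> (forall x, A x -> B (h x)) ->
  \esum_(x in A) f (h x) <= \esum_(y in B) f y.
Proof.
move=> hinj hAB; rewrite -(esum_image A h); last by [].
by apply: esum_sub => _ [x Ax <-]; apply: hAB.
Qed.

Lemma esum_prod_lty (T U : choiceType) (A : set T) (B : set U) (f : T -> RR) (g : U -> RR) :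
  (forall x, 0 <= f x)%R -> (forall y, 0 <= g y)%R ->
  \esum_(x in A) (f x)%:E < +oo -> \esum_(y in B) (g y)%:E < +oo ->
  \esum_(z in A `*` B) (f z.1 * g z.2)%:E < +oo.
Proof.
move=> f0 g0 fA gB.
have -> : A `*` B = A `*`` (fun=> B) by [].
rewrite -(@esum_esum _ _ _ A (fun=> B) (fun x y => (f x * g y)%:E)); last first.
  by move=> i j _ _; rewrite lee_fin mulr_ge0.
have gBf : \esum_(y in B) (g y)%:E \is a fin_num.
  by rewrite ge0_fin_numE // esum_ge0 // => y _; rewrite lee_fin.
rewrite (_ : \esum_(i in A) _ = (fine (\esum_(y in B) (g y)%:E))%:E * \esum_(i in A) (f i)%:E).
  by rewrite lte_mul_pinfty // lee_fin fine_ge0 // esum_ge0 // => y _; rewrite lee_fin.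
rewrite -esumZl; first last.
- by move=> x _; rewrite lee_fin.
- by rewrite fine_ge0 // esum_ge0 // => y _; rewrite lee_fin.
apply: eq_esum => i _; rewrite fineK // muleC -esumZl //.
by move=> y _; rewrite lee_fin.
Qed.
End Sums.

Section LatticeReps.
Variable n : nat.

(* Reduce the coordinates along a maximal free family of lattice vectors modulo m. *)
Lemma bounded_reps (L : set 'rV[RR]_n) (m : nat) : (0 < m)%N ->
  L 0 -> (forall u v, L u -> L v -> L (u - v)) ->
  exists B : RR, forall u, L u -> exists2 v, L v & forall i, `|(u - v *+ m) 0 i| <= B.
Proof.
move=> m0 L0 LB.
have LN u : L u -> L (- u) by move=> Lu; rewrite -sub0r; apply: LB.
have LD u v : L u -> L v -> L (u + v) by move=> Lu /LN Lv; rewrite -[v]opprK; apply: LB.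
have LZ u (z : int) : L u -> L (z%:~R *: u).
  move=> Lu; have LM k : L (k%:R *: u).
    by elim: k => [|k IH]; rewrite ?scale0r // -natr1 scalerDl scale1r; apply: LD.
  case: z => k; first exact: LM.
  by rewrite NegzE rmorphN scaleNr; apply/LN/LM.
pose P r := `[< exists A : 'M[RR]_(r, n), row_free A /\ forall i, L (row i A) >].
have P0 : exists r, P r.
  by exists 0%N; apply/asboolP; exists 0; split=> [|[]//]; rewrite /row_free mxrank0.
have Pn r : P r -> (r <= n)%N.
  by move=> /asboolP[A [/eqP fA _]]; rewrite -{1}fA; apply: rank_leq_col.
case: (ex_maxnP P0 Pn) => r /asboolP[A [freeA LA]] rmax.
have spanA u : L u -> (u <= A)%MS.
  move=> Lu; apply/negPn/negP => uA.
  suff /rmax : P (r + 1)%N by rewrite addn1 ltnn.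
  apply/asboolP; exists (col_mx A u); split; last first.
    move=> i; rewrite -(splitK i); case: (fintype.split i) => j /=.
      by rewrite rowKu.
    by rewrite rowKd row_id.
  rewrite /row_free eqn_leq rank_leq_row /= -addsmxE addn1 -{1}(eqP freeA).
  by apply: rank_ltmx; rewrite ltmxE addsmxSl addsmx_sub submx_refl.
pose mR : RR := m%:R; have mR0 : 0 < mR by rewrite ltr0n.
exists (\sum_i \sum_k mR * `|A k i|) => u Lu.
have /submxP[X Du] := spanA u Lu.
pose z k := Num.floor (X 0 k / mR).
exists (\sum_k (z k)%:~R *: row k A).
  by apply: big_ind => // k _; apply: LZ.
move=> i; have -> : (u - (\sum_k (z k)%:~R *: row k A) *+ m) 0 i =
    \sum_k (X 0 k - mR * (z k)%:~R) * A k i.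
  rewrite Du !mxE mulmxnE summxE -mulr_natl mulr_sumr -sumrB; apply: eq_bigr => k _.
  by rewrite !mxE mulrBl mulrA.
rewrite (bigD1 i) //= -[leLHS]addr0 lerD ?sumr_ge0 //; last first.
  by move=> j _; apply: sumr_ge0 => k _; rewrite mulr_ge0 // ltW.
rewrite (le_trans (ler_norm_sum _ _ _)) // ler_sum // => k _.
rewrite normrM ler_wpM2r // ler_norml; have /andP[z1 z2] := floor_itv (X 0 k / mR).
rewrite -/(z k) in z1 z2; rewrite ler_pdivlMr // in z1; rewrite ltr_pdivrMr // rmorphD in z2.
apply/andP; split; nra.
Qed.
End LatticeReps.

Section SumOK.
Variables (n : nat) (F : fieldExtType rat) (sigma : 'I_n -> {rmorphism F -> RR}).
Hypotheses (n_gt1 : (1 < n)%N) (dimF : \dim {:F} = n) (sig_inj : injective sigma).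

Definition wt (x : F) : RR := \prod_(i < n) (1 + sigma i x ^+ 2)^-1.

Let box (x : F) i : nat := Num.trunc (n%:R * `|sigma i x|).
Let neg (x : F) i : bool := sigma i x < 0.

Let box_inj (x y : F) : OK x -> OK y -> box x =1 box y -> neg x =1 neg y -> x = y.
Proof.
move=> Ox Oy bxy nxy; apply/eqP; rewrite -subr_eq0; apply/eqP.
apply: (OK_small_eq0 n_gt1 dimF sig_inj (OKB Ox Oy)) => i.
have n0 : 0 < n%:R :> RR by rewrite ltr0n ltnW.
have p1 : 0 <= n%:R * `|sigma i x| by rewrite mulr_ge0.
have p2 : 0 <= n%:R * `|sigma i y| by rewrite mulr_ge0.
have /andP[a1 a2] := truncn_itv p1; have /andP[b1 b2] := truncn_itv p2.
have := nxy i; rewrite /neg => nxyi.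
have := bxy i; rewrite /box => bxyi; rewrite -bxyi in b1 b2; rewrite -natr1 in a2 b2.
rewrite -(ltr_pM2l n0) divff ?gt_eqF // rmorphB.
have -> : n%:R * `|sigma i x - sigma i y| = `|n%:R * `|sigma i x| - n%:R * `|sigma i y| |.
  rewrite -mulrBr normrM (gtr0_norm n0); congr (_ * _).
  case: (ltP (sigma i x) 0) nxyi => x0; case: (ltP (sigma i y) 0) => y0 // _.
    by rewrite (ltr0_norm x0) (ltr0_norm y0) -opprD normrN.
  by rewrite (ger0_norm x0) (ger0_norm y0).
rewrite ltr_norml; apply/andP; split; lra.
Qed.

Let sum_inv_sqr (M : nat) : \sum_(j < M) (1 + (j%:R : RR) ^+ 2)^-1 <= 3.
Proof.
(* Telescoping bound: 3 - 2/(M+1) equals the first term 1 at M = 0, and 1/(1+(u+1)^2) <= 2/(u+1) -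
   2/(u+2). *)
suff : \sum_(j < M.+1) (1 + (j%:R : RR) ^+ 2)^-1 <= 3 - 2 / (M.+1)%:R.
  rewrite big_ord_recr => h; apply: le_trans (le_trans h _).
    by rewrite lerDl invr_ge0 addr_ge0 ?sqr_ge0.
  by rewrite gerBl divr_ge0.
elim: M => [|M IH]; first by rewrite big_ord1 expr0n /= addr0 invr1; lra.
rewrite big_ord_recr /=; set S := \sum_(j < M.+1) _ in IH *.
rewrite (le_trans (lerD IH (lexx _))) //.
rewrite -!natr1; have M0 : 0 <= M%:R :> RR by []; move: M0; move: (M%:R : RR) => u u0.
have : (1 + (u + 1) ^+ 2)^-1 <= 2 / (u + 1) - 2 / (u + 1 + 1); last lra.
have -> : 2 / (u + 1) - 2 / (u + 1 + 1) = 2 / ((u + 1) * (u + 2)).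
  by field; apply/andP; split; apply: lt0r_neq0; lra.
rewrite -[leLHS]mul1r ler_pdivrMr; last by nra.
rewrite mulrAC ler_pdivlMr; nra.
Qed.

(* Signs and integer parts of n |x_i| determine x in O: if all |y_i| < 1/n then Tr(y^2) < 1. *)
Lemma esum_wt : (\esum_(x in @OK F) (wt x)%:E < +oo)%E.
Proof.
(* Per coordinate: 1 + x_i^2 is at least n^-2 (1 + j^2) with j the integer part of n |x_i|, the sum
   over j is at most 3, and there are two signs. *)
pose K : RR := (n%:R ^+ 2 * 6) ^+ n.
apply: (@le_lt_trans _ _ K%:E); last exact: ltry.
apply: ge_ereal_sup => _ [X [finX XO] <-]; rewrite fsbig_finite //= sumEFin lee_fin.
set s : seq F := finmap.enum_fset (fset_set X).
have us : uniq s by apply: finmap.fset_uniq.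
have sO x : x \in s -> OK x by rewrite in_fset_set // inE => /XO.
pose M := \max_(x <- s) \max_(i < n) box x i.
have boxM x i : x \in s -> (box x i <= M)%N.
  move=> xs; apply: (@leq_trans (\max_(i < n) box x i)); first exact: leq_bigmax.
  exact: (@leq_bigmax_seq _ s xpredT (fun x => \max_(i < n) box x i)).
pose code x : {ffun 'I_n -> bool * 'I_M.+1} := [ffun i => (neg x i, inord (box x i))].
have code_inj : {in s &, injective code}.
  move=> x y xs ys /ffunP E; apply: box_inj; try exact: sO.
    by move=> i; have := E i; rewrite !ffunE => -[_ /(congr1 val)]; rewrite /= !inordK // ltnS boxM.
  by move=> i; have := E i; rewrite !ffunE => -[].
pose h (f : {ffun 'I_n -> bool * 'I_M.+1}) : RR := \prod_i (n%:R ^+ 2 * (1 + ((f i).2%:R : RR) ^+ 2)^-1).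
have h0 f : 0 <= h f.
  by apply: prodr_ge0 => i _; rewrite mulr_ge0 ?sqr_ge0 // invr_ge0 addr_ge0 ?sqr_ge0.
have wth x : x \in s -> wt x <= h (code x).
  move=> xs; apply: ler_prod => i _; rewrite invr_ge0 addr_ge0 ?sqr_ge0 //= ffunE /= inordK ?ltnS ?boxM //.
  have p1 : 0 <= n%:R * `|sigma i x| by rewrite mulr_ge0.
  have /andP[a1 _] := truncn_itv p1; rewrite -/(box x i) in a1.
  have n1 : 1 <= n%:R :> RR by rewrite ler1n ltnW.
  have b0 : 0 <= (box x i)%:R :> RR by [].
  rewrite -[sigma i x ^+ 2]real_normK ?num_real //.
  move: a1 n1 b0 (normr_ge0 (sigma i x)); move: (n%:R : RR) ((box x i)%:R : RR) `|sigma i x| => N b t.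
  move=> bNt N1 b0 t0.
  rewrite -[leLHS]mul1r ler_pdivrMr; last by nra.
  rewrite mulrAC ler_pdivlMr; last by nra.
  have : b ^+ 2 <= (N * t) ^+ 2 by rewrite lerXn2r ?nnegrE //; nra.
  rewrite exprMn; have : 1 <= N ^+ 2 by nra.
  lra.
rewrite big_seq (le_trans (ler_sum _ (fun x xs => wth x xs))) // -big_seq.
rewrite -(big_map code xpredT h) (le_trans (y := \sum_f h f)) //.
  rewrite big_uniq /=; last by rewrite map_inj_in_uniq.
  by rewrite [leRHS](bigID (mem (map code s))) /= lerDl sumr_ge0.
rewrite /h -(bigA_distr_bigA (fun i (p : bool * 'I_M.+1) => n%:R ^+ 2 * (1 + (p.2%:R : RR) ^+ 2)^-1)).
rewrite big_const_ord iter_mulr_1 /K lerXn2r ?nnegrE ?mulr_ge0 ?sqr_ge0 //.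
  by apply: sumr_ge0 => p _; rewrite mulr_ge0 ?sqr_ge0 // invr_ge0 addr_ge0 ?sqr_ge0.
rewrite -mulr_sumr ler_wpM2l ?sqr_ge0 //.
rewrite -(pair_bigA _ (fun (_ : bool) (j : 'I_M.+1) => (1 + (j%:R : RR) ^+ 2)^-1)) /= big_bool /=.
by have := sum_inv_sqr M.+1; lra.
Qed.

End SumOK.
(** * Absolutely convergent sums *)

Section RealSums.
Variable T : choiceType.
Implicit Types (D : set T) (g h u v : T -> RR).
Local Open Scope ereal_scope.

Definition rsum D g : RR :=
  (fine (\esum_(x in D) (Num.max (g x) 0)%:E) - fine (\esum_(x in D) (Num.max (- g x) 0)%:E))%R.

Definition rsummable D g : Prop := \esum_(x in D) `|g x|%:E < +oo.

Let esum_fin D u : (forall x, 0 <= u x)%R -> \esum_(x in D) (u x)%:E < +oo ->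
  \esum_(x in D) (u x)%:E \is a fin_num.
Proof. by move=> u0 uf; rewrite ge0_fin_numE // esum_ge0 // => x _; rewrite lee_fin. Qed.

Let max0 (a : RR) : (0 <= Num.max a 0)%R. Proof. by rewrite le_max lexx orbT. Qed.

Let pos_fin D g : rsummable D g -> \esum_(x in D) (Num.max (g x) 0)%:E \is a fin_num.
Proof.
move=> gs; rewrite ge0_fin_numE; last by apply: esum_ge0 => x _; rewrite lee_fin.
move: gs; rewrite /rsummable; apply: le_lt_trans.
by apply: le_esum => x _; rewrite lee_fin ge_max normr_ge0 ler_norm.
Qed.

Lemma rsummableN D g : rsummable D g -> rsummable D (fun x => - g x)%R.
Proof. by rewrite /rsummable; under [in X in _ -> X]eq_esum do rewrite normrN. Qed.

(** Any splitting into two summable non-negative parts gives the same value, since max(u-v, 0) + v =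
    max(v-u, 0) + u. Linearity then follows by choosing convenient parts. *)
Lemma rsumB D u v : (forall x, 0 <= u x)%R -> (forall x, 0 <= v x)%R ->
  \esum_(x in D) (u x)%:E < +oo -> \esum_(x in D) (v x)%:E < +oo ->
  rsum D (fun x => u x - v x)%R =
  (fine (\esum_(x in D) (u x)%:E) - fine (\esum_(x in D) (v x)%:E))%R.
Proof.
move=> u0 v0 us vs.
have gs : rsummable D (fun x => u x - v x)%R.
  apply: (@le_lt_trans _ _ (\esum_(x in D) ((u x)%:E + (v x)%:E))).
    apply: le_esum => x _; rewrite -EFinD lee_fin (le_trans (ler_normB _ _)) //.
    by rewrite !ger0_norm.
  by rewrite esumD ?lte_add_pinfty // => x _; rewrite lee_fin.
have := pos_fin gs; have := pos_fin (rsummableN gs); rewrite /rsum.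
have := esum_fin u0 us; have := esum_fin v0 vs.
have : \esum_(x in D) (Num.max (u x - v x) 0)%:E + \esum_(x in D) (v x)%:E =
       \esum_(x in D) (Num.max (- (u x - v x)) 0)%:E + \esum_(x in D) (u x)%:E.
  rewrite -!esumD; try by move=> x _; rewrite lee_fin.
  apply: eq_esum => x _; rewrite -!EFinD; congr _%:E.
  by rewrite !maxEle; case: ifP; case: ifP => /=; lra.
move=> E fv fu fn fp; move: E; rewrite -(fineK fv) -(fineK fu) -(fineK fn) -(fineK fp).
by rewrite -!EFinD => -[E]; lra.
Qed.

Let posneg (a : RR) : (a = Num.max a 0 - Num.max (- a) 0)%R.
Proof. by rewrite !maxEle; case: ifP; case: ifP => /=; lra. Qed.

Lemma eq_rsum D g h : (forall x, D x -> g x = h x) -> rsum D g = rsum D h.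
Proof. by move=> E; rewrite /rsum; congr (fine _ - fine _)%R; apply: eq_esum => x /E ->. Qed.

Let parts_lty D g : rsummable D g ->
  \esum_(x in D) (Num.max (g x) 0)%:E < +oo /\ \esum_(x in D) (Num.max (- g x) 0)%:E < +oo.
Proof. by move=> gs; rewrite !ltey_eq !pos_fin //; apply: rsummableN. Qed.

Lemma rsumD D g h : rsummable D g -> rsummable D h ->
  rsum D (fun x => g x + h x)%R = (rsum D g + rsum D h)%R.
Proof.
move=> gs hs; have [gp gn] := parts_lty gs; have [hp hn] := parts_lty hs.
rewrite (@eq_rsum _ _ (fun x => (Num.max (g x) 0 + Num.max (h x) 0) - (Num.max (- g x) 0 + Num.max (- h x) 0))%R); last first.
  by move=> x _; rewrite {1}[g x]posneg {1}[h x]posneg; lra.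
rewrite rsumB; try by move=> x; rewrite addr_ge0.
- under eq_esum do rewrite EFinD; under [in X in (_ - X)%R]eq_esum do rewrite EFinD.
  rewrite !esumD; try by move=> x _; rewrite lee_fin.
  rewrite !fineD ?pos_fin //; try exact: rsummableN.
  by rewrite /rsum; lra.
- by under eq_esum do rewrite EFinD; rewrite esumD ?lte_add_pinfty // => x _; rewrite lee_fin.
- by under eq_esum do rewrite EFinD; rewrite esumD ?lte_add_pinfty // => x _; rewrite lee_fin.
Qed.

Lemma rsumN D g : rsum D (fun x => - g x)%R = (- rsum D g)%R.
Proof. by rewrite /rsum opprB; congr (_ - fine _)%R; apply: eq_esum => x _; rewrite opprK. Qed.

Lemma rsumZ D (c : RR) g : rsummable D g -> rsum D (fun x => c * g x)%R = (c * rsum D g)%R.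
Proof.
wlog c0 : c g / (0 <= c)%R.
  move=> hw gs; case: (leP 0%R c) => [c0|c0]; first exact: hw.
  rewrite -[RHS]opprK -mulNr -hw ?oppr_ge0 ?(ltW c0) // -rsumN; apply: eq_rsum => x _.
  by rewrite mulNr opprK.
move=> gs; have [gp gn] := parts_lty gs.
have scale (u : T -> RR) : (forall x, 0 <= u x)%R -> \esum_(x in D) (c * u x)%:E = c%:E * \esum_(x in D) (u x)%:E.
  by move=> u0; rewrite -esumZl // => x _; rewrite lee_fin.
rewrite (@eq_rsum _ _ (fun x => c * Num.max (g x) 0 - c * Num.max (- g x) 0)%R); last first.
  by move=> x _; rewrite -mulrBr -posneg.
rewrite rsumB ?scale //; try by move=> x; rewrite mulr_ge0.
- rewrite -(fineK (pos_fin gs)) -(fineK (pos_fin (rsummableN gs))) -!EFinM /= /rsum.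
  lra.
- by rewrite lte_mul_pinfty.
- by rewrite lte_mul_pinfty.
Qed.

Lemma rsum_split D (B : set T) g : rsummable D g ->
  rsum D g = (rsum (D `&` B) g + rsum (D `&` ~` B) g)%R.
Proof.
move=> gs; rewrite /rsum (esumID B D); last by move=> x _; rewrite lee_fin.
rewrite (esumID B D (fun x => (Num.max (- g x) 0)%:E)); last by move=> x _; rewrite lee_fin.
have sub A h : A `<=` D -> rsummable D h -> \esum_(x in A) (Num.max (h x) 0)%:E \is a fin_num.
  by move=> AD hs; apply: pos_fin; move: hs; rewrite /rsummable; apply: le_lt_trans; apply: esum_sub.
have gN := rsummableN gs; have DB := @subIsetl _ D B; have DC := @subIsetl _ D (~` B).
rewrite (fineD (sub _ _ DB gs) (sub _ _ DC gs)) (fineD (sub _ _ DB gN) (sub _ _ DC gN)).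
lra.
Qed.

Lemma esum_fibers (U : choiceType) (p : T -> U) D (f : T -> \bar RR) :
  (forall x, D x -> 0 <= f x) ->
  \esum_(x in D) f x = \esum_(y in p @` D) \esum_(x in D `&` (p @^-1` [set y])) f x.
Proof.
move=> f0; rewrite esum_esum; last by move=> i j _ [] /f0.
rewrite (@reindex_esum _ _ _ D _ (fun x => (p x, x))) //; split.
- by move=> x Dx /=; split=> //; exists x.
- by move=> x y _ _ [].
- by move=> [y x] [/= _ [Dx /= <-]]; exists x.
Qed.

(** Fibre by fibre the positive and negative parts have equal sums, and sums of non-negative terms
    may be grouped freely; the number of fibres does not matter. *)
Lemma rsum_fibers_eq0 (U : choiceType) (p : T -> U) D g : rsummable D g ->
  (forall y, (p @` D) y -> rsum (D `&` (p @^-1` [set y])) g = 0%R) -> rsum D g = 0%R.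
Proof.
move=> gs h0; apply/eqP; rewrite subr_eq0; apply/eqP; congr fine.
rewrite (esum_fibers p) ; last by move=> x _; rewrite lee_fin.
rewrite [RHS](esum_fibers p); last by move=> x _; rewrite lee_fin.
apply: eq_esum => y Dy; have gsy : rsummable (D `&` (p @^-1` [set y])) g.
  by move: gs; rewrite /rsummable; apply: le_lt_trans; apply: esum_sub => x [].
have /eqP := h0 y Dy; rewrite subr_eq0 => /eqP E.
by rewrite -(fineK (pos_fin gsy)) -(fineK (pos_fin (rsummableN gsy))) E.
Qed.

End RealSums.

Lemma rsum_reindex (T U : choiceType) (A : set T) (B : set U) (h : T -> U) g :
  set_bij A B h -> rsum B g = rsum A (g \o h).
Proof. by move=> hb; rewrite /rsum !(reindex_esum A B h). Qed.

(** The sum of ones over [B] encodes its cardinality, and its being below infinity encodes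
    finiteness. *)
Lemma rsum_prod (T U : choiceType) (A : set T) (B : set U) (g : T -> RR) :
  rsummable A g -> (\esum_(y in B) (1%R : RR)%:E < +oo)%E ->
  rsum (A `*` B) (g \o fst) = fine (\esum_(y in B) (1%R : RR)%:E)%E * rsum A g.
Proof.
move=> gs B1; have Bf : (\esum_(y in B) (1%R : RR)%:E \is a fin_num)%E.
  by rewrite ge0_fin_numE // esum_ge0.
have E (u : T -> RR) : (forall x, 0 <= u x) ->
    (\esum_(x in A `*` B) (u x.1)%:E = (fine (\esum_(y in B) (1%R : RR)%:E))%:E * \esum_(x in A) (u x)%:E)%E.
  move=> u0; have -> : A `*` B = A `*`` (fun=> B) by [].
  rewrite -(@esum_esum _ _ _ A (fun=> B) (fun x _ => (u x)%:E)); last by move=> *; rewrite lee_fin.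
  rewrite -esumZl; first last.
  - by move=> x _; rewrite lee_fin.
  - by rewrite fine_ge0 // esum_ge0.
  apply: eq_esum => x _; rewrite fineK // muleC -esumZl //.
  by apply: eq_esum => y _; rewrite mule1.
have max0 (a : RR) : 0 <= Num.max a 0 by rewrite le_max lexx orbT.
rewrite /rsum /= (E (fun x => Num.max (g x) 0)) // (E (fun x => Num.max (- g x) 0)) // mulrBr.
have pf (h : T -> RR) : rsummable A h -> (\esum_(x in A) (Num.max (h x) 0)%:E \is a fin_num)%E.
  move=> hs; rewrite ge0_fin_numE; last by apply: esum_ge0 => x _; rewrite lee_fin.
  move: hs; rewrite /rsummable; apply: le_lt_trans.
  by apply: le_esum => x _; rewrite lee_fin ge_max normr_ge0 ler_norm.
by rewrite !fineM // pf //; apply: rsummableN.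
Qed.

Section ComplexSums.
Notation C := (complex RR).

Definition csummable (T : choiceType) (D : set T) (f : T -> C) :=
  rsummable D (fun x => complex.Re (f x)) /\ rsummable D (fun x => complex.Im (f x)).

Lemma csumE (T : choiceType) (D : set T) (f : T -> C) :
  csum D f = Complex (rsum D (fun x => complex.Re (f x))) (rsum D (fun x => complex.Im (f x))).
Proof. by []. Qed.

Lemma csummable_sub (T : choiceType) (A D : set T) (f : T -> C) :
  A `<=` D -> csummable D f -> csummable A f.
Proof. by move=> AD [h1 h2]; split; [move: h1 | move: h2]; rewrite /rsummable; apply: le_lt_trans; apply: esum_sub. Qed.

Lemma eq_csum (T : choiceType) (D : set T) (f g : T -> C) :
  (forall x, D x -> f x = g x) -> csum D f = csum D g.
Proof. by move=> E; rewrite !csumE; congr Complex; apply: eq_rsum => x /E ->. Qed.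

Lemma csum_reindex (T U : choiceType) (A : set T) (B : set U) (h : T -> U) (f : U -> C) :
  set_bij A B h -> csum B f = csum A (f \o h).
Proof. by move=> hb; rewrite !csumE !(rsum_reindex _ hb). Qed.

Lemma csum_split (T : choiceType) (D B : set T) (f : T -> C) : csummable D f ->
  csum D f = csum (D `&` B) f + csum (D `&` ~` B) f.
Proof. by move=> [h1 h2]; rewrite !csumE (rsum_split B h1) (rsum_split B h2). Qed.

Lemma csum_fibers_eq0 (T U : choiceType) (p : T -> U) (D : set T) (f : T -> C) : csummable D f ->
  (forall y, (p @` D) y -> csum (D `&` (p @^-1` [set y])) f = 0) -> csum D f = 0.
Proof.
move=> [h1 h2] h0; rewrite csumE !(@rsum_fibers_eq0 _ _ p) // => y /h0; rewrite csumE => -[] //.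
Qed.

Lemma csummableZ (T : choiceType) (D : set T) (c : C) (f : T -> C) : csummable D f ->
  csummable D (fun x => c * f x).
Proof.
move=> [h1 h2]; case: c => a b; pose B := `|a| + `|b|.
have bound (g : T -> RR) : (forall x, D x -> `|g x| <= B * (`|complex.Re (f x)| + `|complex.Im (f x)|)) ->
    rsummable D g.
  move=> gB; apply: (@le_lt_trans _ _ (\esum_(x in D) (B%:E * (`|complex.Re (f x)|%:E + `|complex.Im (f x)|%:E)))%E).
    by apply: le_esum => x /gB; rewrite -EFinD -EFinM lee_fin.
  rewrite esumZl ?addr_ge0 //; last by move=> x _; rewrite -EFinD lee_fin addr_ge0.
  rewrite lte_mul_pinfty ?lee_fin ?addr_ge0 // esumD ?lte_add_pinfty // => x _; exact: normr_ge0.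
have key (u w x y : RR) : `|u * x| + `|w * y| <= (`|u| + `|w|) * (`|x| + `|y|).
  rewrite !normrM; have := normr_ge0 u; have := normr_ge0 w.
  by have := normr_ge0 x; have := normr_ge0 y; nra.
split; apply: bound => x _; case: (f x) => r s /=.
  by rewrite (le_trans (ler_normB _ _)).
by rewrite (le_trans (ler_normD _ _)) // [`|r| + _]addrC.
Qed.

Lemma csumZ (T : choiceType) (D : set T) (c : C) (f : T -> C) : csummable D f ->
  csum D (fun x => c * f x) = c * csum D f.
Proof.
move=> [h1 h2]; rewrite !csumE; case: c => a b.
have sZ (c : RR) (g : T -> RR) : rsummable D g -> rsummable D (fun x => c * g x).
  rewrite /rsummable => gs; under eq_esum do rewrite normrM EFinM.
  by rewrite esumZl // ?lte_mul_pinfty // ?lee_fin // => x _; rewrite lee_fin.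
have E x : (Complex a b) * f x = Complex (a * complex.Re (f x) + - (b * complex.Im (f x))) (a * complex.Im (f x) + b * complex.Re (f x)).
  by case: (f x).
congr Complex.
  under eq_rsum do rewrite E /=.
  rewrite rsumD ?rsumN ?rsumZ //; first exact: sZ.
  exact/rsummableN/sZ.
by under eq_rsum do rewrite E /=; rewrite rsumD ?rsumZ //; apply: sZ.
Qed.

Lemma csum_prod (T U : choiceType) (A : set T) (B : set U) (f : T -> C) :
  csummable A f -> (\esum_(y in B) (1%R : RR)%:E < +oo)%E ->
  csum (A `*` B) (f \o fst) = Complex (fine (\esum_(y in B) (1%R : RR)%:E)%E) 0 * csum A f.
Proof.
move=> [h1 h2] B1; rewrite !csumE.
rewrite (rsum_prod (g := fun x => complex.Re (f x))) // (rsum_prod (g := fun x => complex.Im (f x))) //.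
by congr Complex; rewrite mul0r ?subr0 ?addr0.
Qed.

End ComplexSums.
(** * Units and residues modulo bounded sets *)

Section Units.
Variables (n : nat) (F : fieldExtType rat) (sigma : 'I_n -> {rmorphism F -> RR}).

Lemma unitOM (x y : F) : unitO x -> unitO y -> unitO (x * y).
Proof.
move=> [Ox [x0 Ox']] [Oy [y0 Oy']]; split; first exact: OKM.
by rewrite mulf_neq0 // invfM; split=> //; apply: OKM.
Qed.

Lemma unitOV (x : F) : unitO x -> unitO x^-1.
Proof. by move=> [Ox [x0 Ox']]; split; rewrite ?invr_eq0 ?invrK. Qed.

Lemma unitO1 : unitO (1 : F).
Proof. by split; [exact: OK1 | rewrite oner_neq0 invr1; split=> //; exact: OK1]. Qed.

Lemma unitO_posM (x y : F) : unitO_pos sigma x -> unitO_pos sigma y -> unitO_pos sigma (x * y).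
Proof.
move=> [ux px] [uy py]; split; first exact: unitOM.
by move=> i; rewrite rmorphM mulr_gt0.
Qed.

Lemma unitO_posV (x : F) : unitO_pos sigma x -> unitO_pos sigma x^-1.
Proof. by move=> [ux px]; split; [exact: unitOV | move=> i; rewrite fmorphV invr_gt0]. Qed.

Lemma unitO_pos1 : unitO_pos sigma 1.
Proof. by split; [exact: unitO1 | move=> i; rewrite rmorph1 ltr01]. Qed.

Lemma unitO_sqr_pos (x : F) : unitO x -> unitO_pos sigma (x ^+ 2).
Proof.
move=> ux; split; first by rewrite expr2; apply: unitOM.
by move=> i; rewrite rmorphXn lt_def sqr_ge0 expf_neq0 // fmorph_eq0; case: ux => _ [].
Qed.

(** Replaces finiteness of totally positive units modulo squares. Their logarithm vectors form a
    group; reducing it modulo 2 subtracts 2 log f for a unit f, which is multiplication by the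
    square of u = f^-1. Exponentiating the bound gives both inequalities. *)
Lemma unit_square_reps : exists2 B : RR, 0 < B &
  forall e, unitO_pos sigma e -> exists2 u, unitO u &
    forall i, B^-1 <= sigma i (u ^+ 2 * e) <= B.
Proof.
pose L : set 'rV[RR]_n := [set v | exists2 e, unitO_pos sigma e & v = \row_i ln (sigma i e)].
have L0 : L 0.
  exists 1; first exact: unitO_pos1.
  by apply/rowP => i; rewrite !mxE rmorph1 ln1.
have LB u v : L u -> L v -> L (u - v).
  move=> [a [ua pa] ->] [b [ub pb] ->]; exists (a / b).
    by apply: unitO_posM; [|apply: unitO_posV].
  apply/rowP => i; rewrite !mxE rmorphM fmorphV lnM ?posrE ?invr_gt0 //.
  by rewrite lnV ?posrE.
have [B HB] := bounded_reps (m := 2) isT L0 LB.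
exists (expR B); first exact: expR_gt0.
move=> e pe; have [_ [f pf ->] fB] := HB _ (ex_intro2 _ _ e pe erefl).
exists f^-1; first by apply: unitOV; case: pf.
move=> i; have := fB i; rewrite !mxE -mulr2n ler_norml => /andP[b1 b2].
have pei : 0 < sigma i e by case: pe.
have pfi : 0 < sigma i f by case: pf.
have g0 : 0 < sigma i (f^-1 ^+ 2 * e).
  by rewrite rmorphM rmorphXn fmorphV mulr_gt0 // exprn_gt0 // invr_gt0.
have <- : expR (ln (sigma i e) - ln (sigma i f) *+ 2) = sigma i (f^-1 ^+ 2 * e).
  rewrite -[RHS]lnK ?posrE //; congr expR.
  rewrite rmorphM rmorphXn fmorphV lnM ?posrE ?exprn_gt0 ?invr_gt0 //.
  by rewrite lnXn ?invr_gt0 // lnV ?posrE // addrC mulNrn.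
by rewrite -expRN !ler_expR b1.
Qed.

(** Some positive integer m has m/al integral, so reduction modulo m O is in particular reduction
    modulo al O. *)
Lemma residue_reps (al : F) : OK al -> al != 0 -> exists2 B : RR, 0 <= B &
  forall x, OK x -> exists2 y, OK y & forall i, `|sigma i (x - al * y)| <= B.
Proof.
move=> Oal al0; have [d d0 Od] := OK_scale al^-1.
pose m : nat := `|d|%N.
have m0 : (0 < m)%N by rewrite absz_gt0.
have Om : OK (m%:R * al^-1).
  have [E|E] : m%:R = d%:~R :> F \/ m%:R = - d%:~R :> F.
    by rewrite /m pmulrn abszE; case: (ger0P d) => _; [left | right; rewrite rmorphN].
  - by rewrite E.
  - by rewrite E mulNr; apply: OKN.
pose L : set 'rV[RR]_n := [set v | exists2 x, OK x & v = \row_i sigma i x].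
have L0 : L 0.
  exists 0; first exact: OK0.
  by apply/rowP => i; rewrite !mxE rmorph0.
have LB u v : L u -> L v -> L (u - v).
  move=> [a Oa ->] [b Ob ->]; exists (a - b); first exact: OKB.
  by apply/rowP => i; rewrite !mxE rmorphB.
have [B HB] := bounded_reps m0 L0 LB.
exists `|B|; first exact: normr_ge0.
move=> x Ox; have [_ [f Of ->] fB] := HB _ (ex_intro2 _ _ x Ox erefl).
exists (m%:R * al^-1 * f); first exact: OKM.
move=> i; apply: le_trans (ler_norm B); apply: le_trans (fB i).
rewrite !mxE mulmxnE !mxE rmorphB !rmorphM fmorphV rmorph_nat.
rewrite (_ : _ * _ = sigma i f *+ m) // -[RHS]mulr_natl mulrA mulrCA divff ?mulr1 //.
by rewrite fmorph_eq0.
Qed.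

End Units.
(** * The exponential and the local estimate *)

Section ComplexAux.
Notation C := (complex RR).
Notation nc := (@ComplexField.Normc.normc RR).

Lemma cexpD (z w : C) : cexp (z + w) = cexp z * cexp w.
Proof.
case: z w => a b [c d]; rewrite /cexp /= exp.expRD trigo.cosD trigo.sinD.
by apply/eqP; rewrite eq_complex /=; apply/andP; split; apply/eqP; ring.
Qed.

Lemma cexp0 : cexp 0 = 1.
Proof. by rewrite /cexp /= exp.expR0 cos0 sin0 mulr0 mul1r. Qed.

Lemma cexp_2pi_int (m : int) : cexp (Complex 0 (2 * pi) * Complex m%:~R 0) = 1.
Proof.
have E (t : RR) : Complex 0 (2 * pi) * Complex t 0 = Complex 0 (pi *+ 2 * t).
  by apply/eqP; rewrite eq_complex /=; apply/andP; split; apply/eqP; rewrite -mulr_natl; ring.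
have nat k : cexp (Complex 0 (2 * pi) * Complex k%:R 0) = 1.
  elim: k => [|k IH]; first by rewrite E mulr0 (_ : Complex 0 0 = 0) // cexp0.
  rewrite -[k.+1%:R]natr1 (_ : Complex (k%:R + 1) 0 = Complex k%:R 0 + Complex 1 0); last first.
    by apply/eqP; rewrite eq_complex /= addr0 !eqxx.
  rewrite mulrDr cexpD IH mul1r E mulr1 /cexp /= exp.expR0 cos2pi sin2pi mulr0 mul1r //.
case: m => k; first exact: nat.
have := cexpD (Complex 0 (2 * pi) * Complex (Negz k)%:~R 0) (Complex 0 (2 * pi) * Complex k.+1%:R 0).
rewrite nat mulr1 -mulrDr NegzE rmorphN => <-.
rewrite (_ : _ + _ = 0) ?mulr0 ?cexp0 //.
by apply/eqP; rewrite eq_complex /= addr0 addNr !eqxx.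
Qed.

(** Only the fractional part r of t matters, and for 0 < r < 1 the real part is 1 - 2 sin(pi r)^2 <
    1. *)
Lemma cexp_2pi_eq1 (t : RR) : cexp (Complex 0 (2 * pi) * Complex t 0) = 1 ->
  exists m : int, t = m%:~R.
Proof.
pose m := Num.floor t; pose r := t - m%:~R; have /andP[m1 m2] := floor_itv t.
rewrite (_ : Complex t 0 = Complex m%:~R 0 + Complex r 0); last first.
  by apply/eqP; rewrite eq_complex /= addr0 subrKC !eqxx.
rewrite mulrDr cexpD cexp_2pi_int mul1r => /eqP; rewrite /cexp eq_complex /= => /andP[/eqP E _].
exists m; apply/eqP; rewrite -subr_eq0 -/r; apply/negPn/negP => r0.
have r01 : 0 < r < 1.
  rewrite lt_def r0 subr_ge0 m1 /= ltrBlDr addrC; move: m2; rewrite rmorphD //.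
have pi0 : 0 < (pi : RR) := pi_gt0 RR.
have s0 : 0 < sin (pi * r) by apply: sin_gt0_pi; case/andP: r01 => ? ?; apply/andP; split; nra.
move: E; rewrite !(mul0r, mulr0, subr0, add0r, addr0) oppr0 exp.expR0 mul1r.
rewrite (_ : 2 * pi * r = pi * r + pi * r); last by ring.
rewrite trigo.cosD; have := cos2Dsin2 (pi * r); move: s0; set s := sin _; set c := cos _ => s0.
rewrite !expr2; nra.
Qed.

Lemma normc_sqr (a b : RR) : nc (Complex a b) ^+ 2 = a ^+ 2 + b ^+ 2.
Proof. by rewrite /= sqr_sqrtr // addr_ge0 ?sqr_ge0. Qed.

Lemma normcX (z : C) k : nc (z ^+ k) = nc z ^+ k.
Proof.
elim: k => [|k IH]; first by rewrite !expr0 ComplexField.Normc.normc1.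
by rewrite !exprS ComplexField.Normc.normcM IH.
Qed.

Lemma normc_prod (I : Type) (r : seq I) (P : pred I) (f : I -> C) :
  nc (\prod_(i <- r | P i) f i) = \prod_(i <- r | P i) nc (f i).
Proof. apply: (big_morph nc); [exact: ComplexField.Normc.normcM | exact: ComplexField.Normc.normc1]. Qed.

Lemma normc_cexp (z : C) : nc (cexp z) = expR (complex.Re z).
Proof.
rewrite /cexp /= !exprMn -mulrDr cos2Dsin2 mulr1 sqrtr_sqr ger0_norm //.
Qed.

Lemma Re_le_normc (z : C) : `|complex.Re z| <= nc z.
Proof.
case: z => a b /=; rewrite -sqrtr_sqr ler_sqrt ?addr_ge0 ?sqr_ge0 //.
by rewrite lerDl sqr_ge0.
Qed.

Lemma Im_le_normc (z : C) : `|complex.Im z| <= nc z.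
Proof.
case: z => a b /=; rewrite -sqrtr_sqr ler_sqrt ?addr_ge0 ?sqr_ge0 //.
by rewrite lerDr sqr_ge0.
Qed.

Lemma csummable_normc (T : choiceType) (D : set T) (f : T -> C) (g : T -> RR) :
  (forall x, D x -> nc (f x) <= g x) -> (\esum_(x in D) (g x)%:E < +oo)%E -> csummable D f.
Proof.
move=> fg; move=> gs; split; move: gs; apply: le_lt_trans; apply: le_esum => x /fg h;
  rewrite lee_fin (le_trans _ h) //; [exact: Re_le_normc | exact: Im_le_normc].
Qed.

(* The exponential tames the singularity of W^-K at W = 0. *)
Lemma pow_exp_bound (A : RR) (K : nat) : 0 < A -> (1 < K)%N -> exists2 B : RR, 0 <= B &
  forall W : RR, 0 < W -> W^-1 ^+ K * expR (- (A / W)) * (1 + W) ^+ 2 <= B.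
Proof.
move=> A0 K1; have K0 : 0 < K%:R :> RR by rewrite ltr0n ltnW.
(* With s = 1/W the expression is exp(-As) s^(K-2) (1+s)^2 <= exp(-As) (1+s)^K, and 1+s <=
   (1+K/A)(1+As/K) <= (1+K/A) exp(As/K); the K-th power cancels exp(-As). *)
exists ((1 + K%:R / A) ^+ K); first by rewrite exprn_ge0 // addr_ge0 // divr_ge0 // ltW.
move=> W W0; pose s := W^-1; have s0 : 0 < s by rewrite invr_gt0.
have -> : W^-1 ^+ K * expR (- (A / W)) * (1 + W) ^+ 2 = expR (- (A * s)) * (s ^+ (K - 2) * (1 + s) ^+ 2).
  rewrite -/s -{1}(subnK K1) exprD mulrAC [RHS]mulrC; congr (_ * _).
  rewrite -mulrA -exprMn; congr (_ * _ ^+ 2).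
  by rewrite mulrDr mulr1 /s mulVf ?gt_eqF // addrC.
have h1 : s ^+ (K - 2) * (1 + s) ^+ 2 <= (1 + s) ^+ K.
  rewrite -{2}(subnK K1) exprD ler_wpM2r ?sqr_ge0 // lerXn2r ?nnegrE ?addr_ge0 //; try exact: ltW.
  by rewrite lerDr.
have h2 : (1 + s) ^+ K <= (1 + K%:R / A) ^+ K * expR (A * s).
  have -> : expR (A * s) = expR (A * s / K%:R) ^+ K.
    by rewrite -expRM_natl; congr expR; rewrite [RHS]mulrC divfK ?gt_eqF.
  rewrite -exprMn lerXn2r ?nnegrE ?mulr_ge0 ?addr_ge0 ?expR_ge0 ?divr_ge0 //; try exact: ltW.
  apply: (@le_trans _ _ ((1 + K%:R / A) * (1 + A * s / K%:R))).
    rewrite mulrDl mul1r mulrDr mulr1 [K%:R / A * _]mulrC mulrA divfK ?gt_eqF //.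
    rewrite [A * s]mulrC mulfK ?gt_eqF //.
    have : 0 <= s * A / K%:R by rewrite divr_ge0 // mulr_ge0 // ltW.
    have : 0 <= K%:R / A by rewrite divr_ge0 // ltW.
    lra.
  by rewrite ler_wpM2l ?expR_ge1Dx // addr_ge0 // divr_ge0 // ltW.
rewrite expRN mulrC ler_pdivrMr ?expR_gt0 //.
exact: le_trans h1 h2.
Qed.

(** Here W = |tau c z + d|^2 with z = x + iy. Its imaginary part bounds c^2 by a multiple of W, and
    d is the real part minus tau c x, so d^2 is also bounded by a multiple of W. Hence
    (1+c^2)(1+d^2) is at most a constant times (1+W)^2, the factor absorbed by [pow_exp_bound] as
    k/2 >= 2. *)
Lemma local_bound (k : nat) (x y tau A : RR) : (2 < k)%N -> ~~ odd k -> 0 < y -> tau != 0 -> 0 < A ->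
  exists2 B : RR, 0 <= B & forall c d : RR, let W := (tau * c * x + d) ^+ 2 + (tau * c * y) ^+ 2 in
   0 < W -> W^-1 ^+ k./2 * expR (- (A / W)) <= B * ((1 + c ^+ 2)^-1 * (1 + d ^+ 2)^-1).
Proof.
move=> k2 ke y0 t0 A0.
have K1 : (1 < k./2)%N.
  by have := odd_double_half k; rewrite (negbTE ke) add0n => E; rewrite -(ltn_double 1) E.
have [B B0 HB] := pow_exp_bound A0 K1.
have ty : 0 < (tau * y) ^+ 2 by rewrite exprn_even_gt0 //= mulf_neq0 ?(lt0r_neq0 y0).
pose B1 := 1 + ((tau * y) ^+ 2)^-1; pose B2 := 3 + 2 * x ^+ 2 / y ^+ 2.
have y20 : 0 < y ^+ 2 by rewrite exprn_gt0.
have B10 : 0 <= B1 by rewrite addr_ge0 // invr_ge0 ltW.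
have B20 : 0 <= B2 by rewrite addr_ge0 // divr_ge0 ?sqr_ge0 // mulr_ge0 ?sqr_ge0.
exists (B * (B1 * B2)) => [|c d W W0]; first by rewrite !mulr_ge0.
have c1 : 1 + c ^+ 2 <= B1 * (1 + W).
  have : c ^+ 2 <= ((tau * y) ^+ 2)^-1 * W.
    rewrite ler_pdivlMl // /W -exprMn (_ : tau * y * c = tau * c * y); last by ring.
    by rewrite lerDr sqr_ge0.
  have : 0 <= ((tau * y) ^+ 2)^-1 by rewrite invr_ge0 ltW.
  rewrite /B1; move: ((_ ^+ 2)^-1) => u; nra.
have d1 : 1 + d ^+ 2 <= B2 * (1 + W).
  have : (tau * c * x) ^+ 2 <= x ^+ 2 / y ^+ 2 * W.
    rewrite [leRHS]mulrAC ler_pdivlMr // /W.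
    rewrite (_ : (tau * c * x) ^+ 2 * y ^+ 2 = x ^+ 2 * (tau * c * y) ^+ 2); last by ring.
    by rewrite ler_wpM2l ?sqr_ge0 // lerDr sqr_ge0.
  have : 0 <= x ^+ 2 / y ^+ 2 by rewrite divr_ge0 ?sqr_ge0 ?ltW.
  have : (tau * c * x + d) ^+ 2 <= W by rewrite /W lerDl sqr_ge0.
  have := W0; rewrite /B2 -(mulrA 2 (x ^+ 2)); clearbody W; move: (tau * c * x) (x ^+ 2 / y ^+ 2) => u v.
  move=> W0' h1 h2 h3; have : d ^+ 2 <= 2 * ((u + d) ^+ 2 + u ^+ 2).
    by rewrite -subr_ge0 (_ : _ - _ = (2 * u + d) ^+ 2) ?sqr_ge0 //; ring.
  nra.
have p1 : 0 < 1 + c ^+ 2 by rewrite ltr_pwDl ?sqr_ge0.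
have p2 : 0 < 1 + d ^+ 2 by rewrite ltr_pwDl ?sqr_ge0.
rewrite -invfM ler_pdivlMr ?mulr_gt0 //.
apply: le_trans (_ : (W^-1 ^+ k./2 * expR (- (A / W))) * (B1 * (1 + W) * (B2 * (1 + W))) <= _).
  rewrite ler_wpM2l //; last by rewrite ler_pM // ltW.
  by rewrite mulr_ge0 ?expR_ge0 // exprn_ge0 // invr_ge0 ltW.
rewrite (_ : _ * _ = (W^-1 ^+ k./2 * expR (- (A / W)) * (1 + W) ^+ 2) * (B1 * B2)); last by ring.
by rewrite ler_wpM2r ?mulr_ge0 // HB.
Qed.

End ComplexAux.
(** * Matrices acting on the terms of the series *)

Section Matrices.
Context (F : fieldExtType rat).
Implicit Types (g h : 'M[F]_2).

Definition mk (a b c d : F) : 'M[F]_2 := \matrix_(i, j)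
  if i == i0 then (if j == i0 then a else b) else (if j == i0 then c else d).

Lemma mkE a b c d : [/\ ma (mk a b c d) = a, mb (mk a b c d) = b,
  mc (mk a b c d) = c & md (mk a b c d) = d].
Proof. by rewrite /ma /mb /mc /md !mxE. Qed.

Lemma mat_ext g h : ma g = ma h -> mb g = mb h -> mc g = mc h -> md g = md h -> g = h.
Proof.
move=> ea eb ec ed; apply/matrixP => i j.
have two (x : 'I_2) : x = i0 \/ x = i1.
  by case: x => [[|[|//]] xlt]; [left | right]; apply: val_inj.
by case: (two i) => ->; case: (two j) => ->.
Qed.

Lemma mulmE g h : [/\ ma (g *m h) = ma g * ma h + mb g * mc h,
  mb (g *m h) = ma g * mb h + mb g * md h,
  mc (g *m h) = mc g * ma h + md g * mc h &
  md (g *m h) = mc g * mb h + md g * md h].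
Proof.
by split; rewrite /ma /mb /mc /md !mxE big_ord_recl big_ord1 /=;
  congr (g _ _ * h _ _ + g _ _ * h _ _); apply: val_inj.
Qed.

Definition dt g := ma g * md g - mb g * mc g.

Lemma dtM g h : dt (g *m h) = dt g * dt h.
Proof. by rewrite /dt; case: (mulmE g h) => -> -> -> ->; ring. Qed.

(** For e a unit and b in the translation lattice this is left multiplication by a general element
    of Z(Gamma)N(Gamma); units multiply and translations add. *)
Definition act (e b : F) g := (e%:M *m transl b) *m g.

Lemma actE e b g : [/\ ma (act e b g) = e * (ma g + b * mc g),
  mb (act e b g) = e * (mb g + b * md g),
  mc (act e b g) = e * mc g & md (act e b g) = e * md g].
Proof.
rewrite /act -mulmxA mul_scalar_mx /ma /mb /mc /md.
have [] := mulmE (transl b) g; rewrite /ma /mb /mc /md /transl !mxE /= => -> -> -> ->.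
by rewrite !mul1r !mul0r !add0r.
Qed.

Lemma act_mul e b g h : act e b g *m h = act e b (g *m h).
Proof. by rewrite /act mulmxA. Qed.

Lemma act_act e b e' b' g : act e b (act e' b' g) = act (e * e') (b + b') g.
Proof.
by case: (actE e b (act e' b' g)) (actE e' b' g) (actE (e * e') (b + b') g)
  => A B C D [A' B' C' D'] [A'' B'' C'' D''];
  apply: mat_ext; rewrite ?A ?B ?C ?D ?A' ?B' ?C' ?D' ?A'' ?B'' ?C'' ?D''; ring.
Qed.

Lemma act_id g : act 1 0 g = g.
Proof. by case: (actE 1 0 g) => A B C D; apply: mat_ext; rewrite ?A ?B ?C ?D; ring. Qed.

Lemma dt_act e b g : dt (act e b g) = e ^+ 2 * dt g.
Proof. by rewrite /dt; case: (actE e b g) => -> -> -> ->; ring. Qed.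

End Matrices.

Section Terms.
Variables (n : nat) (F : fieldExtType rat) (sigma : 'I_n -> {rmorphism F -> RR}).
Hypotheses (dimF : \dim {:F} = n) (sig_inj : injective sigma).
Variables (k : nat) (ke : ~~ odd k).
Notation C := (complex RR).
Notation cm := (cemb sigma).
Implicit Types (g h : 'M[F]_2) (z : 'I_n -> C).

Lemma cembD i x y : cm i (x + y) = cm i x + cm i y.
Proof. by rewrite /cemb rmorphD; apply/eqP; rewrite eq_complex /= addr0 !eqxx. Qed.
Lemma cembM i x y : cm i (x * y) = cm i x * cm i y.
Proof.
rewrite /cemb rmorphM; apply/eqP; rewrite eq_complex /=.
by rewrite !mulr0 !mul0r subr0 addr0 !eqxx.
Qed.
Lemma cemb_eq0 i x : (cm i x == 0) = (x == 0).
Proof. by rewrite /cemb eq_complex /= eqxx andbT fmorph_eq0. Qed.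
Lemma cemb1 i : cm i 1 = 1.
Proof. by rewrite /cemb rmorph1. Qed.
Lemma cembV i x : cm i x^-1 = (cm i x)^-1.
Proof.
have [->|x0] := eqVneq x 0.
  by have /eqP := cemb_eq0 i 0; rewrite eqxx invr0 => E; have := cemb_eq0 i 0; rewrite eqxx => /eqP ->; rewrite invr0.
apply: (mulfI (x := cm i x)); first by rewrite cemb_eq0.
by rewrite -cembM !divff ?cemb_eq0 // cemb1.
Qed.

Definition den (z : 'I_n -> C) g i := cm i (mc g) * z i + cm i (md g).
Definition num (z : 'I_n -> C) g i := cm i (ma g) * z i + cm i (mb g).
Definition mobius (g : 'M[F]_2) (z : 'I_n -> C) i := num z g i / den z g i.

Lemma termE mu z g : poincare_term sigma k mu z g =
  (\prod_i den z g i) ^- k * cexp (Complex 0 (2 * pi) * \sum_i cm i mu * mobius g z i).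
Proof. by []. Qed.

Lemma dt_neq0_row g : dt g != 0 -> (mc g != 0) || (md g != 0).
Proof. by apply: contraNT; rewrite negb_or !negbK /dt => /andP[/eqP -> /eqP ->]; rewrite !mulr0 subr0. Qed.

Lemma den_neq0 z g i : upper_half_n z -> dt g != 0 -> den z g i != 0.
Proof.
move=> /(_ i) zi /dt_neq0_row row; rewrite /den /cemb; case: (z i) zi => x y /= y0.
rewrite eq_complex /= !mul0r subr0 !addr0; apply/negP => /andP[/eqP A /eqP B].
move: B => /eqP; rewrite mulf_eq0 (gt_eqF y0) orbF => /eqP c0.
move: A => /eqP; rewrite c0 mul0r add0r fmorph_eq0 => /eqP d0.
by move: row c0 => /orP[|]; rewrite ?d0 ?eqxx // => h /eqP; rewrite fmorph_eq0 (negPf h).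
Qed.

Lemma sum_cemb (x : F) : \sum_i cm i x = Complex (trF sigma x) 0.
Proof.
rewrite /trF /cemb; apply: (big_rec2 (fun (a : C) (r : RR) => a = Complex r 0)) => // i a r _ ->.
by apply/eqP; rewrite eq_complex /= add0r !eqxx.
Qed.

Lemma prod_cemb (x : F) : \prod_i cm i x = Complex (nrF sigma x) 0.
Proof.
rewrite /nrF /cemb; apply: (big_rec2 (fun (a : C) (r : RR) => a = Complex r 0)) => // i a r _ ->.
by apply/eqP; rewrite eq_complex /= !mulr0 !mul0r subr0 addr0 !eqxx.
Qed.

(** The norm of a unit has square 1. This is where even weight makes the terms invariant under the
    centre. *)
Lemma unit_prod_even (e : F) : unitO e -> (\prod_i cm i e) ^+ k = 1.
Proof.
move=> ue; have nE := nrF_unit dimF sig_inj ue.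
rewrite -[k]odd_double_half (negPf ke) add0n -mul2n exprM prod_cemb.
have -> : (Complex (nrF sigma e) 0 ^+ 2 : C) = 1.
  rewrite expr2; apply/eqP; rewrite eq_complex /= -expr2 nE.
  by rewrite !mulr0 !mul0r subr0 addr0 !eqxx.
by rewrite expr1n.
Qed.

Definition etr (x : F) : C := cexp (Complex 0 (2 * pi) * Complex (trF sigma x) 0).

Lemma term_act mu z g e b : upper_half_n z -> dt g != 0 -> unitO e ->
  poincare_term sigma k mu z (act e b g) = etr (mu * b) * poincare_term sigma k mu z g.
Proof.
move=> hz g0 ue; have e0 : e != 0 by case: ue => _ [].
have [A B C' D] := actE e b g.
have denE i : den z (act e b g) i = cm i e * den z g i.
  by rewrite /den C' D !cembM; ring.
have mobE i : mobius (act e b g) z i = mobius g z i + cm i b.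
  rewrite /mobius denE /num A B !cembM !cembD !cembM.
  have := den_neq0 i hz g0; have : cm i e != 0 by rewrite cemb_eq0.
  by rewrite /den => h1 h2; field; rewrite h1 h2.
rewrite !termE (eq_bigr _ (fun i _ => denE i)) big_split /= exprMn unit_prod_even // mul1r.
rewrite mulrCA -cexpD -mulrDr; congr (_ * cexp (_ * _)).
rewrite -sum_cemb -big_split; apply: eq_bigr => i _.
by rewrite mobE mulrDr cembM addrC.
Qed.

Lemma term_diagl mu z g al : poincare_term sigma k mu z (mk al 0 0 1 *m g) =
  poincare_term sigma k (mu * al) z g.
Proof.
have [A B C' D] := mulmE (mk al 0 0 1) g; have [a b c d] := mkE al 0 0 1.
rewrite a b c d in A B C' D; rewrite !termE.
have denE i : den z (mk al 0 0 1 *m g) i = den z g i.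
  by rewrite /den C' D !mul0r !mul1r !add0r.
rewrite (eq_bigr _ (fun i _ => denE i)); congr (_ * cexp (_ * _)).
apply: eq_bigr => i _; rewrite /mobius denE /num A B !mul0r !addr0 !cembM.
by rewrite -!mulrA -mulrDr !mulrA.
Qed.

Lemma term_diagr mu z g p : p != 0 -> poincare_term sigma k mu z (mk 1 0 0 p *m g) =
  (Complex (nrF sigma p) 0) ^- k * poincare_term sigma k (mu / p) z g.
Proof.
move=> p0; have [A B C' D] := mulmE (mk 1 0 0 p) g; have [a b c d] := mkE 1 0 0 p.
rewrite a b c d in A B C' D; rewrite !termE.
have denE i : den z (mk 1 0 0 p *m g) i = cm i p * den z g i.
  by rewrite /den C' D !mul0r !add0r !cembM; ring.
rewrite (eq_bigr _ (fun i _ => denE i)) big_split /= prod_cemb exprMn invfM -mulrA.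
congr (_ * (_ * cexp (_ * _))).
apply: eq_bigr => i _; rewrite /mobius denE /num A B !mul0r !mul1r !addr0 cembM cembV invfM.
ring.
Qed.

(** The cocycle relation: den(gh, z) = den(h, z) den(g, hz), and (gh)z = g(hz). *)
Lemma term_mulr mu z g h : upper_half_n z -> dt h != 0 -> poincare_term sigma k mu z (g *m h) =
  (\prod_i den z h i) ^- k * poincare_term sigma k mu (mobius h z) g.
Proof.
move=> hz h0; have [A B C' D] := mulmE g h.
have denE i : den z (g *m h) i = den z h i * den (mobius h z) g i.
  have := den_neq0 i hz h0; rewrite /mobius /den /num C' D !cembD !cembM => w0.
  by field.
rewrite !termE (eq_bigr _ (fun i _ => denE i)) big_split /= exprMn invfM -mulrA.
congr (_ * (_ * cexp (_ * _))).
apply: eq_bigr => i _; congr (_ * _); rewrite {1}/mobius denE [in RHS]/mobius invfM.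
rewrite mulrA; congr (_ / _).
have := den_neq0 i hz h0; rewrite /mobius /den /num A B !cembD !cembM => w0.
by field.
Qed.

Lemma mobius_Im z g i : upper_half_n z -> dt g != 0 ->
  let W := ComplexField.Normc.normc (den z g i) ^+ 2 in
  complex.Im (mobius g z i) = sigma i (dt g) * complex.Im (z i) / W.
Proof.
move=> hz g0 /=; have := den_neq0 i hz g0; rewrite /mobius /den /num /cemb /dt.
rewrite rmorphB !rmorphM.
move: (sigma i (ma g)) (sigma i (mb g)) (sigma i (mc g)) (sigma i (md g)) => a b c d.
case: (z i) => x y; rewrite eq_complex.
have -> : Complex c 0 * Complex x y + Complex d 0 = Complex (c * x + d) (c * y) :> C.
  by apply/eqP; rewrite eq_complex /= !mul0r subr0 !addr0 !eqxx.
have -> : Complex a 0 * Complex x y + Complex b 0 = Complex (a * x + b) (a * y) :> C.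
  by apply/eqP; rewrite eq_complex /= !mul0r subr0 !addr0 !eqxx.
rewrite normc_sqr /= => w0.
have W0 : (c * x + d) ^+ 2 + (c * y) ^+ 2 != 0.
  by rewrite paddr_eq0 ?sqr_ge0 // !sqrf_eq0.
by field.
Qed.

Lemma mobius_upper z g : upper_half_n z -> totpos sigma (dt g) -> upper_half_n (mobius g z).
Proof.
move=> hz gp i; have g0 : dt g != 0.
  by apply/eqP => E; have := gp i; rewrite E rmorph0 ltxx.
rewrite mobius_Im //; apply: divr_gt0; first by rewrite mulr_gt0.
rewrite lt_def sqr_ge0 andbT sqrf_eq0; apply/eqP => /ComplexField.Normc.eq0_normc /eqP.
by rewrite (negPf (den_neq0 i hz g0)).
Qed.

End Terms.
(** * The Hecke relation *)

Section Hecke.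
Variables (n : nat) (F : fieldExtType rat) (sigma : 'I_n -> {rmorphism F -> RR}).
Hypotheses (n_gt1 : (1 < n)%N) (dimF : \dim {:F} = n) (sig_inj : injective sigma).
Variables (k : nat) (k2 : (2 < k)%N) (ke : ~~ odd k).
Variables (c nn : set F) (q x0 v : F).
Hypotheses (qp : totpos sigma q) (x0p : totpos sigma x0) (Ov : OK v) (v0 : v != 0).
Hypotheses (codE : codifferent sigma = principal x0) (cE : c = principal q) (nnE : nn = principal v).
Notation C := (complex RR).
Implicit Types (g h : 'M[F]_2) (z : 'I_n -> C) (al mu : F).

(** A generator of c times the different, the latter being generated by x0^-1. Upper right entries
    of Gamma thus lie in t^-1 O and lower left entries in t v O. *)
Let t := q / x0.

Lemma totpos_neq0 x : totpos sigma x -> x != 0.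
Proof.
move=> xp; apply/eqP => E; have := xp (Ordinal (ltnW n_gt1)).
by rewrite E rmorph0 ltxx.
Qed.

Let q0 : q != 0. Proof. exact: totpos_neq0. Qed.
Let x00 : x0 != 0. Proof. exact: totpos_neq0. Qed.
Let t0 : t != 0. Proof. by rewrite mulf_neq0 // invr_eq0. Qed.

Let diffE : different sigma = principal x0^-1.
Proof. by rewrite /different codE principal_inv. Qed.

Lemma bbP b : ideal_inv (ideal_mul c (different sigma)) b <-> OK (t * b).
Proof. by rewrite diffE cE principal_mul principal_inv // principalP ?invr_eq0 // invrK mulrC. Qed.

Lemma ccP x : ideal_mul (ideal_mul c nn) (different sigma) x <-> OK (x / (t * v)).
Proof.
by rewrite diffE cE nnE !principal_mul principalP ?mulf_neq0 ?invr_eq0 // mulrAC.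
Qed.

(** The set M_al. Allowing a totally positive unit next to al keeps it stable under Gamma and under
    scalar units, which multiply determinants by squares; for al = 1 it is Gamma itself. *)
Definition Mset al : set 'M[F]_2 := [set g | [/\ OK (ma g), OK (md g),
  OK (t * mb g), OK (mc g / (t * v)) & unitO_pos sigma (dt g / al)]].

Lemma Gamma0E : Gamma0 sigma c nn = Mset 1.
Proof.
apply/seteqP; split=> g [Oa Od Ob Oc ud]; split=> //.
- by rewrite -bbP.
- by rewrite -ccP.
- by rewrite divr1.
- by rewrite bbP.
- by rewrite ccP.
- by rewrite divr1 in ud.
Qed.

Lemma Mset_mct al g : Mset al g -> OK (mc g / t).
Proof.
move=> [_ _ _ Oc _]; rewrite (_ : _ / t = mc g / (t * v) * v); first exact: OKM.
by field; rewrite v0 t0.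
Qed.

Lemma Mset_dt al g : totpos sigma al -> Mset al g -> totpos sigma (dt g).
Proof.
move=> alp [_ _ _ _ [_ up]] i; have := mulr_gt0 (alp i) (up i).
by rewrite -rmorphM mulrC divfK // totpos_neq0.
Qed.

Lemma Mset_dt0 al g : totpos sigma al -> Mset al g -> dt g != 0.
Proof. by move=> alp Mg; apply/totpos_neq0/Mset_dt/Mg. Qed.

Lemma Mset_act al g e b : unitO e -> OK (t * b) -> Mset al g -> Mset al (act e b g).
Proof.
move=> ue Ob Mg; have Oct := Mset_mct Mg; case: Mg => Oa Od Ob' Oc ud.
have Oe : OK e by case: ue.
rewrite /Mset /= dt_act; case: (actE e b g) => -> -> -> ->; split.
- apply: OKM => //; apply: OKD => //.
  by rewrite (_ : b * _ = (t * b) * (mc g / t)); [exact: OKM | by field].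
- exact: OKM.
- rewrite mulrCA; apply: OKM => //; rewrite mulrDr mulrA; apply: OKD => //; exact: OKM.
- by rewrite -mulrA; apply: OKM.
- by rewrite -mulrA; apply: unitO_posM => //; apply: unitO_sqr_pos.
Qed.

Lemma Mset_mul al g h : Mset 1 g -> Mset al h -> Mset al (g *m h).
Proof.
move=> Mg Mh; have Ogt := Mset_mct Mg; have Oht := Mset_mct Mh.
case: Mg Mh => ga gd gb gc gu [ha hd hb hc hu].
rewrite /Mset /= dtM; case: (mulmE g h) => -> -> -> ->; split.
- apply: OKD; first exact: OKM.
  by rewrite (_ : _ * _ = (t * mb g) * (mc h / t)); [exact: OKM | by field].
- apply: OKD; last exact: OKM.
  by rewrite (_ : _ * _ = (mc g / t) * (t * mb h)); [exact: OKM | by field].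
- rewrite mulrDr; apply: OKD; first by rewrite mulrCA; apply: OKM.
  by rewrite mulrA; apply: OKM.
- rewrite mulrDl; apply: OKD; first by rewrite mulrAC; apply: OKM.
  by rewrite -mulrA; apply: OKM.
- by rewrite -mulrA; apply: unitO_posM => //; rewrite divr1 in gu.
Qed.

Lemma Mset_inv g : Mset 1 g -> exists2 h, Mset 1 h & h *m g = 1%:M.
Proof.
case=> ga gd gb gc; rewrite divr1 => gu; have [[Ou [u0 Ou']] up] := gu.
pose D := dt g; exists (mk (md g / D) (- mb g / D) (- mc g / D) (ma g / D)).
  have [A B C' D'] := mkE (md g / D) (- mb g / D) (- mc g / D) (ma g / D).
  rewrite /Mset /= /dt A B C' D'; split.
  - exact: OKM.
  - exact: OKM.
  - by rewrite mulrA; apply: OKM => //; rewrite mulrN; apply: OKN.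
  - by rewrite mulrAC; apply: OKM => //; rewrite mulNr; apply: OKN.
  - rewrite divr1 (_ : _ - _ = D^-1); first exact: unitO_posV.
    by rewrite /D /dt; field; apply: contra_neq u0; rewrite /dt.
have [A B C' D'] := mkE (md g / D) (- mb g / D) (- mc g / D) (ma g / D).
have [A1 B1 C1 D1] := mulmE (mk (md g / D) (- mb g / D) (- mc g / D) (ma g / D)) g.
have D0 : ma g * md g - mb g * mc g != 0 by [].
have [E1 E2 E3 E4] : [/\ ma (1%:M : 'M[F]_2) = 1, mb (1%:M : 'M[F]_2) = 0,
    mc (1%:M : 'M[F]_2) = 0 & md (1%:M : 'M[F]_2) = 1].
  by rewrite /ma /mb /mc /md !mxE.
apply: mat_ext; rewrite ?A1 ?B1 ?C1 ?D1 ?A ?B ?C' ?D' ?E1 ?E2 ?E3 ?E4; rewrite /D /dt; field; exact: D0.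
Qed.

Notation coset := (ZNcoset sigma c).

Lemma cosetP g h : coset g h <-> exists e b, [/\ unitO e, OK (t * b) & h = act e b g].
Proof.
split; first by move=> [e ue [b /bbP Ob <-]]; exists e, b.
by move=> [e [b [ue Ob ->]]]; exists e => //; exists b => //; apply/bbP.
Qed.

Lemma coset_refl g : coset g g.
Proof.
apply/cosetP; exists 1, 0; split; [exact: unitO1 | rewrite mulr0; exact: OK0 | by rewrite act_id].
Qed.

Lemma coset_eq g h : coset g h -> coset h = coset g.
Proof.
move/cosetP => [e [b [ue Ob ->]]]; have [Oe [e0 Oe']] := ue.
apply/seteqP; split=> m /cosetP[e' [b' [ue' Ob' ->]]]; apply/cosetP.
  exists (e' * e), (b' + b); split; [exact: unitOM | rewrite mulrDr; exact: OKD | exact: act_act].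
exists (e' / e), (b' - b); split; [exact/unitOM/unitOV | rewrite mulrBr; exact: OKB |].
by rewrite act_act divfK // subrK.
Qed.

Definition cosets (A : set 'M[F]_2) : set (set 'M[F]_2) :=
  [set S | exists2 g, A g & S = coset g].

(* Independent of the representative picked by [xget] when [mu] lies in [c]: see [tm_coset]. *)
Definition tm mu z (S : set 'M[F]_2) := poincare_term sigma k mu z (xget 0 S).

Lemma xget_coset g : coset g (xget 0 (coset g)).
Proof. exact: xgetPex (ex_intro _ g (coset_refl g)). Qed.

(** As mu is in (q) and b in (x0/q), the product lies in the codifferent (x0), so its trace is an
    integer. *)
Lemma etr_int mu b : c mu -> OK (t * b) -> etr sigma (mu * b) = 1.
Proof.
rewrite cE principalP // => Omu Ob.
have : codifferent sigma (x0 * ((mu / q) * (t * b))) by rewrite codE; exists ((mu / q) * (t * b)) => //; apply: OKM.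
move=> /(_ 1 (OK1 F)) [m]; rewrite mulr1 => E.
rewrite /etr (_ : mu * b = x0 * (mu / q * (t * b))); first by rewrite E cexp_2pi_int.
by rewrite /t; field; rewrite x00 q0.
Qed.

Lemma tm_coset mu z g : c mu -> upper_half_n z -> dt g != 0 ->
  tm mu z (coset g) = poincare_term sigma k mu z g.
Proof.
move=> cmu hz g0; rewrite /tm; have /cosetP[e [b [ue Ob ->]]] := xget_coset g.
by rewrite term_act // etr_int // mul1r.
Qed.

Lemma poincareE mu z : poincare sigma k c nn mu z = csum (cosets (Mset 1)) (tm mu z).
Proof. by rewrite /poincare /ZN_cosets Gamma0E. Qed.

(** Serves the two changes of variable that carry whole cosets to whole cosets: right multiplication
    by a fixed matrix, and a unipotent translation. *)
Lemma image_cosets_bij (L : 'M[F]_2 -> 'M[F]_2) (A B : set 'M[F]_2) :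
  injective L -> (forall g, coset (L g) = L @` coset g) -> B = L @` A ->
  set_bij (cosets A) (cosets B) (fun S => L @` S).
Proof.
move=> Linj Lc ->; split.
- by move=> _ [g Ag ->]; exists (L g); [exists g | rewrite Lc].
- move=> S S' _ _ /= E; apply/seteqP; split=> m Sm.
    by have [m' Sm' /Linj <-] : (L @` S') (L m) by rewrite -E; exists m.
  by have [m' Sm' /Linj <-] : (L @` S) (L m) by rewrite E; exists m.
- by move=> _ [_ [g Ag <-] ->]; exists (coset g); [exists g | rewrite Lc].
Qed.

(** Equal bottom rows and determinants force h to be g translated by b = (ma g * mb h - ma h * mb g)
    / dt g; the congruences of the top rows modulo al compensate the division by the determinant, a
    unit times al. *)
Lemma same_row_coset al g h : al != 0 -> OK al -> Mset al g -> Mset al h ->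
  mc g = mc h -> md g = md h -> dt g = dt h ->
  OK ((ma h - ma g) / al) -> OK (t * (mb h - mb g) / al) -> coset g = coset h.
Proof.
move=> al0 Oal Mg Mh ec ed eD Oa Ob; apply/esym/coset_eq/cosetP.
have [[_ [u0 Ou']] up] : unitO_pos sigma (dt g / al) by case: Mg.
have D0 : dt g != 0 by apply: contraNneq u0 => ->; rewrite mul0r.
pose b := (ma g * mb h - ma h * mb g) / dt g.
have Db : dt g = ma g * md g - mb g * mc g by [].
have Dh : dt g = ma h * md g - mb h * mc g by rewrite eD /dt ec ed.
exists 1, b; split; first exact: unitO1.
  have -> : t * b = (dt g / al)^-1 * (ma g * (t * (mb h - mb g) / al) - (t * mb g) * ((ma h - ma g) / al)).
    by rewrite /b; field; rewrite al0 D0.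
  case: Mg => Oag _ Obg _ _; apply: OKM => //.
  by apply: OKB; apply: OKM.
have bD : b * dt g = ma g * mb h - ma h * mb g by rewrite /b divfK.
have bc : b * mc g = ma h - ma g.
  apply: (mulfI D0); rewrite mulrA [dt g * b]mulrC bD.
  have -> : dt g * (ma h - ma g) = ma h * (ma g * md g - mb g * mc g) - ma g * (ma h * md g - mb h * mc g).
    by rewrite -Db -Dh; ring.
  ring.
have bd : b * md g = mb h - mb g.
  apply: (mulfI D0); rewrite mulrA [dt g * b]mulrC bD.
  have -> : dt g * (mb h - mb g) = mb h * (ma g * md g - mb g * mc g) - mb g * (ma h * md g - mb h * mc g).
    by rewrite -Db -Dh; ring.
  ring.
have [A B C' D'] := actE 1 b g.
by apply: mat_ext; rewrite ?A ?B ?C' ?D' mul1r ?bc ?bd // addrC subrK.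
Qed.

(** * Absolute convergence of the sums over cosets *)

Notation nc := (@ComplexField.Normc.normc RR).

Lemma wt_ge0 (x : F) : 0 <= wt sigma x.
Proof. by apply: prodr_ge0 => i _; rewrite invr_ge0 addr_ge0 ?sqr_ge0. Qed.

(** Lets a bounded coordinate enter the majorant with its own weight, at the price of a constant. *)
Lemma wt_lower_bound (x : F) (B : RR) : (forall i, `|sigma i x| <= B) ->
  1 <= (1 + B ^+ 2) ^+ n * wt sigma x.
Proof.
move=> xB; rewrite -[X in _ ^+ X](card_ord n) -prodr_const -big_split /=.
rewrite -[leLHS](@big1_eq _ 1 *%R 'I_n (index_enum _) xpredT).
apply: ler_prod => i _; rewrite ler01 /=.
have p0 : 0 < 1 + sigma i x ^+ 2 by rewrite ltr_pwDl ?sqr_ge0.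
rewrite ler_pdivlMr // mul1r lerD2l -[sigma i x ^+ 2]real_normK ?num_real //.
by rewrite lerXn2r ?nnegrE // (le_trans _ (xB i)).
Qed.

Let term_norm mu z g : upper_half_n z -> dt g != 0 ->
  nc (poincare_term sigma k mu z g) = \prod_i ((nc (den sigma z g i) ^+ 2)^-1 ^+ k./2 *
    expR (- (2 * pi * sigma i mu * sigma i (dt g) * complex.Im (z i) / nc (den sigma z g i) ^+ 2))).
Proof.
move=> hz g0; rewrite termE ComplexField.Normc.normcM ComplexField.Normc.normcV normcX normc_prod.
rewrite normc_cexp big_split /=; congr (_ * _).
  rewrite -prodrXl -prodfV; apply: eq_bigr => i _.
  by rewrite exprVn -exprM mul2n -[in LHS](odd_double_half k) (negPf ke).
rewrite -expR_sum; congr expR.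
have ReIm (w : C) : complex.Re (Complex 0 (2 * pi) * w) = - (2 * pi * complex.Im w).
  by case: w => a b /=; rewrite mul0r sub0r.
have ImD (w w' : C) : complex.Im (w + w') = complex.Im w + complex.Im w' by case: w w' => ? ? [].
rewrite ReIm (big_morph (@complex.Im RR) ImD (erefl : complex.Im 0 = 0)) mulr_sumr -sumrN.
apply: eq_bigr => i _; congr (- _).
have -> : complex.Im (cemb sigma i mu * mobius sigma g z i) = sigma i mu * complex.Im (mobius sigma g z i).
  by rewrite /cemb; case: (mobius sigma g z i) => a b /=; rewrite mul0r addr0.
by rewrite mobius_Im // !mulrA.
Qed.

(** By [mobius_Im] a lower bound on det/al bounds the decay exponent below by A_i/W, uniformly in g.
    Then [local_bound] applies in each real place, with tau the conjugate of t v, so that the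
    variables c/(tv) and d are conjugates of elements of O. *)
Let term_bound al mu z (B : RR) : totpos sigma al -> totpos sigma mu -> upper_half_n z -> 0 < B ->
  exists2 K : RR, 0 <= K & forall g, dt g != 0 -> (forall i, B^-1 <= sigma i (dt g / al)) ->
    nc (poincare_term sigma k mu z g) <= K * (wt sigma (mc g / (t * v)) * wt sigma (md g)).
Proof.
move=> alp mup hz B0; pose A i : RR := 2 * pi * sigma i mu * (sigma i al / B) * complex.Im (z i).
have A0 i : 0 < A i by rewrite !mulr_gt0 ?pi_gt0 ?invr_gt0.
have tv0 i : sigma i (t * v) != 0 by rewrite fmorph_eq0 mulf_neq0.
have /choice[K HK] : forall i, exists K : RR, 0 <= K /\ forall a d : RR,
    let W := (sigma i (t * v) * a * complex.Re (z i) + d) ^+ 2 +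
             (sigma i (t * v) * a * complex.Im (z i)) ^+ 2 in
    0 < W -> W^-1 ^+ k./2 * expR (- (A i / W)) <= K * ((1 + a ^+ 2)^-1 * (1 + d ^+ 2)^-1).
  move=> i; have [K K0 HK] := local_bound (complex.Re (z i)) k2 ke (hz i) (tv0 i) (A0 i).
  by exists K.
exists (\prod_i K i) => [|g g0 gB]; first by apply: prodr_ge0 => i _; case: (HK i).
rewrite term_norm // -!big_split /=; apply: ler_prod => i _.
have [K0 HKi] := HK i.
have -> : nc (den sigma z g i) ^+ 2 = (sigma i (t * v) * sigma i (mc g / (t * v)) * complex.Re (z i) + sigma i (md g)) ^+ 2 +
             (sigma i (t * v) * sigma i (mc g / (t * v)) * complex.Im (z i)) ^+ 2.
  have -> : sigma i (t * v) * sigma i (mc g / (t * v)) = sigma i (mc g).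
    by rewrite -rmorphM mulrC divfK // mulf_neq0.
  have -> : den sigma z g i = Complex (sigma i (mc g) * complex.Re (z i) + sigma i (md g)) (sigma i (mc g) * complex.Im (z i)).
    rewrite /den /cemb; case: (z i) => x y /=; apply/eqP.
    by rewrite eq_complex /= !mul0r subr0 !addr0 !eqxx.
  by rewrite normc_sqr.
have := HKi (sigma i (mc g / (t * v))) (sigma i (md g)); set W := _ + _ => /= HW.
have W0 : 0 < W.
  have := den_neq0 sigma i hz g0; rewrite /W -!normc_sqr lt_def sqr_ge0 andbT sqrf_eq0 => w0.
  apply: contraNneq w0 => /ComplexField.Normc.eq0_normc [E1 E2].
  rewrite /den /cemb; move: E1 E2; case: (z i) => x y /=.
  have -> : sigma i (t * v) * sigma i (mc g / (t * v)) = sigma i (mc g).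
    by rewrite -rmorphM mulrC divfK // mulf_neq0.
  by move=> E1 E2; rewrite eq_complex /= !mul0r subr0 !addr0 E1 E2 !eqxx.
apply/andP; split; first by rewrite mulr_ge0 ?expR_ge0 // exprn_ge0 // invr_ge0 ltW.
apply: le_trans (HW W0); rewrite ler_wpM2l ?exprn_ge0 ?invr_ge0 ?(ltW W0) //.
rewrite ler_expR lerN2 ler_wpM2r ?invr_ge0 ?(ltW W0) // /A.
rewrite ler_wpM2r ?(ltW (hz i)) // ler_wpM2l ?mulr_ge0 ?pi_ge0 ?(ltW (mup i)) //.
have := gB i; rewrite rmorphM fmorphV ler_pdivlMr ?alp //.
by rewrite mulrC.
Qed.

(** A coset is encoded injectively by five elements of O. The bottom row gives decay through
    [term_bound]; the other three are bounded, so their weights may be inserted, and the sum is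
    dominated by a constant times the fifth power of the sum of [wt] over O. *)
Lemma summable_tm al mu z : OK al -> totpos sigma al -> c mu -> totpos sigma mu ->
  upper_half_n z -> csummable (cosets (Mset al)) (tm mu z).
Proof.
move=> Oal alp cmu mup hz; have al0 := totpos_neq0 alp.
have [BU BU0 HU] := unit_square_reps sigma.
have [BR BR0 HR] := residue_reps sigma Oal al0.
have /choice[rep Hrep] : forall S, exists g, cosets (Mset al) S ->
    [/\ Mset al g, S = coset g & forall i, BU^-1 <= sigma i (dt g / al) <= BU].
  move=> S; have [[h Mh ->]|] := pselect (cosets (Mset al) S); last by exists 0.
  have [u uu uB] : exists2 u, unitO u & forall i, BU^-1 <= sigma i (u ^+ 2 * (dt h / al)) <= BU.
    by apply: HU; case: Mh.
  have Ot0 : OK (t * 0) by rewrite mulr0; apply: OK0.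
  exists (act u 0 h) => _; split; first exact: Mset_act.
    by apply/esym/coset_eq/cosetP; exists u, 0.
  by move=> i; rewrite dt_act -mulrA.
have /choice[res Hres] : forall x, exists r, OK x ->
    [/\ OK r, OK ((x - r) / al) & forall i, `|sigma i r| <= BR].
  move=> x; have [Ox|] := pselect (OK x); last by exists 0.
  have [y Oy yB] := HR x Ox; exists (x - al * y) => _; split=> //.
    by apply: OKB => //; apply: OKM.
  by rewrite opprB addrC subrK mulrC mulKf.
have resK x y : OK x -> OK y -> res x = res y -> OK ((y - x) / al).
  move=> /Hres[_ O1 _] /Hres[_ O2 _] E.
  have -> : (y - x) / al = (y - res y) / al - (x - res x) / al by rewrite E; ring.
  exact: OKB.
pose OO := @OK F.
(* Rescaled bottom row, determinant over al, and the two top entries modulo al: exactly the data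
   that [same_row_coset] requires. The representative was scaled by a unit to bound the
   determinant. *)
pose enc S := let g := rep S in
  (mc g / (t * v), (md g, (dt g / al, (res (ma g), res (t * mb g))))).
pose G (x : F * (F * (F * (F * F)))) : RR := wt sigma x.1 * (wt sigma x.2.1 *
  (wt sigma x.2.2.1 * (wt sigma x.2.2.2.1 * wt sigma x.2.2.2.2))).
have G0 x : 0 <= G x by rewrite !mulr_ge0 ?wt_ge0.
have Gs : (\esum_(x in OO `*` (OO `*` (OO `*` (OO `*` OO)))) (G x)%:E < +oo)%E.
  have w := esum_wt n_gt1 dimF sig_inj; have w0 := wt_ge0.
  have s2 := esum_prod_lty w0 w0 w w.
  have p2 (x : F * F) : 0 <= wt sigma x.1 * wt sigma x.2 by rewrite mulr_ge0.
  have s3 := esum_prod_lty w0 p2 w s2.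
  have p3 (x : F * (F * F)) : 0 <= wt sigma x.1 * (wt sigma x.2.1 * wt sigma x.2.2) by rewrite !mulr_ge0.
  have s4 := esum_prod_lty w0 p3 w s3.
  have p4 (x : F * (F * (F * F))) : 0 <= wt sigma x.1 * (wt sigma x.2.1 * (wt sigma x.2.2.1 * wt sigma x.2.2.2)) by rewrite !mulr_ge0.
  exact: (esum_prod_lty w0 p4 w s4).
have encO S : cosets (Mset al) S -> (OO `*` (OO `*` (OO `*` (OO `*` OO)))) (enc S).
  move=> /Hrep[[Oa Od Ob Oc [[Ou _] _]] _ _]; rewrite /enc.
  by have [? _ _] := Hres _ Oa; have [? _ _] := Hres _ Ob.
have enc_inj : {in cosets (Mset al) &, injective enc}.
  move=> S S'; rewrite !inE => /Hrep[Mg ES _] /Hrep[Mh ES' _] E.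
  rewrite {1}ES ES'; move: E Mg Mh; rewrite /enc; move: (rep S) (rep S') => g h.
  move=> [ec ed eD ea eb] Mg Mh; have [Oa _ Ob _ _] := Mg; have [Oa' _ Ob' _ _] := Mh.
  apply: (same_row_coset al0 Oal Mg Mh) => //.
  - by apply: (mulIf (invr_neq0 (mulf_neq0 t0 v0))).
  - by apply: (mulIf (invr_neq0 al0)).
  - exact: resK.
  - by rewrite mulrBr; apply: resK.
have [K K0 HK] := term_bound alp mup hz BU0.
pose K' : RR := K * ((1 + BU ^+ 2) ^+ n * ((1 + BR ^+ 2) ^+ n * (1 + BR ^+ 2) ^+ n)).
have pw (B : RR) : 0 <= (1 + B ^+ 2) ^+ n by rewrite exprn_ge0 // addr_ge0 ?sqr_ge0.
have K'0 : 0 <= K' by rewrite !mulr_ge0.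
apply: (csummable_normc (g := fun S => K' * G (enc S))) => [S DS|]; last first.
  under eq_esum do rewrite EFinM.
  rewrite esumZl //; last by move=> x _; rewrite lee_fin.
  rewrite lte_mul_pinfty ?lee_fin //; apply: le_lt_trans Gs.
  exact: (esum_inj_le (fun x => (G x)%:E) enc_inj encO).
have [Mg ES uB] := Hrep _ DS; rewrite {1}ES tm_coset //; last exact: Mset_dt0 Mg.
have [Oa Od Ob _ up] := Mg.
apply: le_trans (HK _ (Mset_dt0 alp Mg) _) _; first by move=> i; case/andP: (uB i).
rewrite /K' /G /= -mulrA ler_wpM2l //.
set w1 := wt sigma _; set w2 := wt sigma _; set w3 := wt sigma _; set w4 := wt sigma _; set w5 := wt sigma _.
have -> : (1 + BU ^+ 2) ^+ n * ((1 + BR ^+ 2) ^+ n * (1 + BR ^+ 2) ^+ n) * (w1 * (w2 * (w3 * (w4 * w5)))) =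
  (w1 * w2) * (((1 + BU ^+ 2) ^+ n * w3) * (((1 + BR ^+ 2) ^+ n * w4) * ((1 + BR ^+ 2) ^+ n * w5))) by ring.
have h3 : 1 <= (1 + BU ^+ 2) ^+ n * w3.
  apply: wt_lower_bound => i; rewrite ger0_norm; first by case/andP: (uB i).
  by apply: ltW; case: up.
have h4 : 1 <= (1 + BR ^+ 2) ^+ n * w4 by apply: wt_lower_bound => i; have [_ _] := Hres _ Oa.
have h5 : 1 <= (1 + BR ^+ 2) ^+ n * w5 by apply: wt_lower_bound => i; have [_ _] := Hres _ Ob.
rewrite -[leLHS]mulr1 ler_wpM2l ?mulr_ge0 ?wt_ge0 //.
by apply: mulr_ege1 => //; apply: mulr_ege1.
Qed.

(** * Orbits of Gamma in M_al *)

Lemma Mset_id : Mset 1 1%:M.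
Proof.
have [E1 E2 E3 E4] : [/\ ma (1%:M : 'M[F]_2) = 1, mb (1%:M : 'M[F]_2) = 0,
    mc (1%:M : 'M[F]_2) = 0 & md (1%:M : 'M[F]_2) = 1].
  by rewrite /ma /mb /mc /md !mxE.
rewrite /Mset /= /dt E1 E2 E3 E4 !mulr0 mul0r mulr1 subr0 divr1.
split; [exact: OK1 | exact: OK1 | exact: OK0 | exact: OK0 | exact: unitO_pos1].
Qed.

Lemma mulmx_inj h : dt h != 0 -> injective (fun m : 'M[F]_2 => m *m h).
Proof.
move=> h0; have E : h *m mk (md h) (- mb h) (- mc h) (ma h) = (dt h)%:M.
  have [A B C' D] := mulmE h (mk (md h) (- mb h) (- mc h) (ma h)).
  have [A1 B1 C1 D1] := mkE (md h) (- mb h) (- mc h) (ma h).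
  have [E1 E2 E3 E4] : [/\ ma ((dt h)%:M) = dt h, mb ((dt h)%:M) = 0,
      mc ((dt h)%:M) = 0 & md ((dt h)%:M) = dt h].
    by rewrite /ma /mb /mc /md !mxE.
  by apply: mat_ext; rewrite ?A ?B ?C' ?D ?A1 ?B1 ?C1 ?D1 ?E1 ?E2 ?E3 ?E4 /dt; ring.
move=> m m' /= /(congr1 (fun x => x *m mk (md h) (- mb h) (- mc h) (ma h))).
by rewrite -!mulmxA E !mul_mx_scalar => /(scalerI h0).
Qed.

Lemma coset_mulr h g : coset (g *m h) = (fun m => m *m h) @` coset g.
Proof.
apply/seteqP; split=> m.
  move=> /cosetP[e [b [ue Ob ->]]]; exists (act e b g); first by apply/cosetP; exists e, b.
  by rewrite act_mul.
by move=> [_ /cosetP[e [b [ue Ob ->]]] <-]; apply/cosetP; exists e, b; rewrite act_mul.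
Qed.

(** The set Gamma S of matrices itself labels the orbit, so no orbit representatives have to be
    chosen. *)
Definition orb (S : set 'M[F]_2) : set 'M[F]_2 :=
  [set m | exists2 y, Mset 1 y & exists2 s, S s & m = y *m s].

Lemma orb_coset g : orb (coset g) = (fun y => y *m g) @` Mset 1.
Proof.
apply/seteqP; split=> m.
  move=> [y My [_ /cosetP[e [b [ue Ob ->]]] ->]].
  exists (y *m act e b 1%:M); first by apply: Mset_mul => //; apply: Mset_act => //; apply: Mset_id.
  by rewrite -mulmxA act_mul mul1mx.
by move=> [y My <-]; exists y => //; exists g => //; apply: coset_refl.
Qed.

Lemma orb_mul y g : Mset 1 y -> orb (coset (y *m g)) = orb (coset g).
Proof.
move=> My; rewrite !orb_coset; apply/seteqP; split=> m [w Mw <-].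
  by exists (w *m y); [apply: Mset_mul | rewrite mulmxA].
have [y' My' E] := Mset_inv My; exists (w *m y'); first exact: Mset_mul.
by rewrite -mulmxA [y' *m _]mulmxA E mul1mx.
Qed.

(** Right multiplication by h carries ZN\Gamma bijectively onto ZN\(Gamma h), and the cocycle
    relation extracts a factor depending only on h and z. *)
Lemma csum_orbit mu z h : c mu -> totpos sigma mu -> upper_half_n z -> totpos sigma (dt h) ->
  csum (cosets ((fun y => y *m h) @` Mset 1)) (tm mu z) =
  (\prod_i den sigma z h i) ^- k * poincare sigma k c nn mu (mobius sigma h z).
Proof.
move=> cmu mup hz hp; have h0 := totpos_neq0 hp.
have hz' := mobius_upper hz hp.
rewrite (csum_reindex _ (image_cosets_bij (mulmx_inj h0) (coset_mulr h) erefl)).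
rewrite poincareE -csumZ; last exact: (summable_tm (OK1 F) (unitO_pos1 sigma).2).
apply: eq_csum => _ [g Mg ->]; have g0 := Mset_dt0 (unitO_pos1 sigma).2 Mg.
by rewrite /= -coset_mulr !tm_coset ?dtM ?mulf_neq0 // term_mulr.
Qed.

Lemma hecke_eq0 al mu z : OK al -> totpos sigma al -> c mu -> totpos sigma mu ->
  upper_half_n z -> poincare_zero sigma k c nn mu -> csum (cosets (Mset al)) (tm mu z) = 0.
Proof.
move=> Oal alp cmu mup hz P0; apply: (csum_fibers_eq0 (p := orb)); first exact: summable_tm.
move=> _ [_ [h Mh ->] <-]; have hp := Mset_dt alp Mh.
rewrite (_ : _ `&` _ = cosets ((fun y => y *m h) @` Mset 1)).
  by rewrite csum_orbit // P0 ?mulr0 //; apply: mobius_upper.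
apply/seteqP; split=> S.
  move=> [[g Mg ->] E]; exists g => //; rewrite -orb_coset -(E : orb _ = _) orb_coset.
  by exists 1%:M; [exact: Mset_id | rewrite mul1mx].
move=> [_ [y My <-] ->]; split; last exact: orb_mul.
by exists (y *m h) => //; apply: Mset_mul.
Qed.

(** * Sorting M_al by the ideal of the bottom row *)

Hypothesis narrow : narrow_class_number_one sigma.

(** With b in t^-1 O this is (c/t) + (d): the lower left entry is rescaled so that the ideal is
    integral. *)
Definition bottom_ideal g : set F :=
  [set x | exists b o, [/\ OK (t * b), OK o & x = mc g * b + md g * o]].

(** Expanding the determinant along the bottom row puts al into the ideal, so a generator divides
    al. *)
Lemma bottom_ideal_principal al g : OK al -> al != 0 -> Mset al g ->
  exists d, [/\ d != 0, OK d, OK (al / d), OK (mc g / (t * d)) /\ OK (md g / d) &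
    bottom_ideal g = principal d].
Proof.
move=> Oal al0 Mg; have Oct := Mset_mct Mg; have [Oa Od Ob Oc [[Ou [u0 Ou']] _]] := Mg.
have D0 : dt g != 0 by apply: contraNneq u0 => ->; rewrite mul0r.
have Ial : bottom_ideal g al.
  exists (- (mb g / (dt g / al))), (ma g / (dt g / al)); split.
  - by rewrite mulrN mulrA; apply/OKN/OKM.
  - exact: OKM.
  - rewrite /dt; field; rewrite al0; exact: D0.
have fI : frac_ideal (bottom_ideal g).
  split.
  - by exists 0, 0; split; rewrite ?mulr0 ?addr0 //; apply: OK0.
  - move=> _ _ [b [w [Ob1 Oo ->]]] [b' [w' [Ob' Oo' ->]]]; exists (b + b'), (w + w').
    by split; [rewrite mulrDr; exact: OKD | exact: OKD | ring].
  - move=> a _ Oa' [b [w [Ob1 Oo ->]]]; exists (a * b), (a * w).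
    by split; [rewrite mulrCA; exact: OKM | exact: OKM | ring].
  - by exists al.
  - exists 1; split; first exact: OK1; split; first exact: oner_neq0.
    move=> _ [b [w [Ob1 Oo ->]]]; rewrite mul1r; apply: OKD; last exact: OKM.
    by rewrite (_ : _ * _ = mc g / t * (t * b)); [exact: OKM | field].
have [d [dp Id]] := narrow fI; have d0 := totpos_neq0 dp.
have mem x : bottom_ideal g x -> OK (x / d) by rewrite Id principalP.
exists d; split=> //.
- have : bottom_ideal g d by rewrite Id; exists 1; [exact: OK1 | rewrite mulr1].
  move=> [b [w [Ob1 Oo ->]]]; apply: OKD; last exact: OKM.
  by rewrite (_ : _ * _ = mc g / t * (t * b)); [exact: OKM | field].
- exact: mem.
- split; last by apply: mem; exists 0, 1; split; rewrite ?mulr0 ?mulr1 ?add0r //; [exact: OK0 | exact: OK1].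
  rewrite invfM mulrA; apply: mem; exists t^-1, 0; split; last by rewrite mulr0 addr0.
    by rewrite mulfV //; apply: OK1.
  exact: OK0.
Qed.

Lemma principal_unit (d : F) : d != 0 -> OK d -> OK d^-1 -> principal d = @OK F.
Proof.
move=> d0 Od Od'; apply/seteqP; split=> x; first by move=> [y Oy <-]; apply: OKM.
by move=> Ox; apply/principalP => //; apply: OKM.
Qed.

Lemma bottom_ideal_act g e b : unitO e -> bottom_ideal (act e b g) = bottom_ideal g.
Proof.
move=> [Oe [e0 Oe']]; have [_ _ C' D] := actE e b g.
apply/seteqP; split=> x [b' [w [Ob Oo ->]]].
  by exists (e * b'), (e * w); rewrite C' D; split; [rewrite mulrCA; exact: OKM | exact: OKM | ring].
exists (b' / e), (w / e); rewrite C' D; split; [rewrite mulrA; exact: OKM | exact: OKM | by field].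
Qed.

Definition bot S := bottom_ideal (xget 0 S).

Lemma bot_coset g : bot (coset g) = bottom_ideal g.
Proof.
by rewrite /bot; have /cosetP[e [b [ue Ob ->]]] := xget_coset g; rewrite bottom_ideal_act.
Qed.

Lemma cosets_bot (A : set 'M[F]_2) (P : set F -> Prop) :
  cosets A `&` [set S | P (bot S)] = cosets [set g | A g /\ P (bottom_ideal g)].
Proof.
apply/seteqP; split=> S.
  by move=> [[g Ag ->]]; rewrite /= bot_coset => Pg; exists g.
by move=> [g [Ag Pg] ->]; split; [exists g | rewrite /= bot_coset].
Qed.

(** Left multiplication by diag(al, 1) turns mu into mu al in each term and preserves the bottom
    row, which is primitive for Gamma. Conversely a primitive bottom row completes to a matrix of
    Gamma. *)
Lemma csum_prim al mu z : OK al -> totpos sigma al -> c mu -> totpos sigma mu -> upper_half_n z ->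
  csum (cosets [set g | Mset al g /\ bottom_ideal g = @OK F]) (tm mu z) =
  poincare sigma k c nn (mu * al) z.
Proof.
move=> Oal alp cmu mup hz; have al0 := totpos_neq0 alp.
pose L g := mk al 0 0 1 *m g.
have LE g : [/\ ma (L g) = al * ma g, mb (L g) = al * mb g, mc (L g) = mc g & md (L g) = md g].
  have [A B C' D] := mulmE (mk al 0 0 1) g; have [a b c' d] := mkE al 0 0 1.
  by rewrite /L A B C' D a b c' d !mul0r !mul1r !add0r !addr0.
have Ldt g : dt (L g) = al * dt g.
  by rewrite /dt; case: (LE g) => -> -> -> ->; ring.
have Lact g e b : L (act e b g) = act e (al * b) (L g).
  have [A B C' D] := LE g; have [A1 B1 C1 D1] := LE (act e b g).
  have [A2 B2 C2 D2] := actE e b g; have [A3 B3 C3 D3] := actE e (al * b) (L g).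
  by apply: mat_ext; rewrite ?A1 ?B1 ?C1 ?D1 ?A2 ?B2 ?C2 ?D2 ?A3 ?B3 ?C3 ?D3 ?A ?B ?C' ?D; ring.
have M1x S : cosets (Mset 1) S -> Mset 1 (xget 0 S) /\ S = coset (xget 0 S).
  move=> [g Mg ->]; have h := xget_coset g; rewrite (coset_eq h); split=> //.
  by move/cosetP: h => [e [b [ue Ob ->]]]; apply: Mset_act.
have LM g : Mset 1 g -> Mset al (L g) /\ bottom_ideal (L g) = @OK F.
  move=> Mg; split.
    case: Mg => Oa Od Ob Oc; rewrite divr1 => ug; rewrite /Mset /= Ldt; case: (LE g) => -> -> -> ->.
    have -> : al * dt g / al = dt g by rewrite mulrAC mulfV // mul1r.
    by split=> //; [exact: OKM | rewrite mulrCA; exact: OKM].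
  have -> : bottom_ideal (L g) = bottom_ideal g by rewrite /bottom_ideal; case: (LE g) => _ _ -> ->.
  have [d [d0 Od Od' _ ->]] := bottom_ideal_principal (OK1 F) (oner_neq0 F) Mg.
  by apply: principal_unit => //; rewrite -[d^-1]mul1r.
(* Translation by b becomes translation by al * b, so the image of a coset is in general only part
   of one; the map takes the coset of the image of a representative instead. *)
rewrite poincareE (@csum_reindex _ _ (cosets (Mset 1)) _ (fun S => coset (L (xget 0 S)))).
  apply: eq_csum => S /M1x[Mg _]; have [MLg _] := LM _ Mg.
  by rewrite /= tm_coset ?(Mset_dt0 alp MLg) // /tm term_diagl.
split.
- by move=> S /M1x[Mg _]; exists (L (xget 0 S)) => //; apply: LM.
- move=> S S'; rewrite !inE => /M1x[Mg ES] /M1x[Mg' ES'] E; rewrite ES ES'.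
  move: Mg Mg' E {ES ES'}; move: (xget 0 S) (xget 0 S') => g g' Mg Mg' E.
  have : coset (L g) (L g') by rewrite E; apply: coset_refl.
  move=> /cosetP[e [b [ue Ob El]]].
  have Ot0 : OK (t * 0) by rewrite mulr0; apply: OK0.
  have <- : coset (act e 0 g) = coset g by apply/coset_eq/cosetP; exists e, 0.
  have [A B C' D] := actE e b (L g); have [A1 B1 C1 D1] := actE e 0 g.
  have [A2 B2 C2 D2] := LE g; have [A3 B3 C3 D3] := LE g'.
  have Mge := Mset_act ue Ot0 Mg.
  apply: (same_row_coset (oner_neq0 F) (OK1 F) Mge Mg').
  + by rewrite C1 -C3 El C' C2.
  + by rewrite D1 -D3 El D D2.
  + by apply: (mulfI al0); rewrite -(Ldt g') El dt_act dt_act Ldt mulrCA.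
  + by rewrite divr1; apply: OKB; [case: Mg' | case: Mge].
  + by rewrite divr1 mulrBr; apply: OKB; [case: Mg' | case: Mge].
- move=> _ [g [Mg Ig] ->]; have : bottom_ideal g 1 by rewrite Ig; apply: OK1.
  move=> [b0 [d0 [Ob0 Od0 E1]]]; have [Oa Od Ob Oc ug] := Mg; have [[Ou _] _] := ug.
  (* The relation 1 = c b0 + d d0 supplies a top row of unit determinant; scaling it by dt g / al
     makes the determinants of L y and g equal. *)
  pose y := mk (d0 * (dt g / al)) (- b0 * (dt g / al)) (mc g) (md g).
  have [Ay By Cy Dy] := mkE (d0 * (dt g / al)) (- b0 * (dt g / al)) (mc g) (md g).
  have dty : dt y = dt g / al.
    by rewrite -[RHS]mulr1 E1 {1}/dt Ay By Cy Dy; ring.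
  have My : Mset 1 y.
    rewrite /Mset /= dty Ay By Cy Dy divr1; split=> //; first exact: OKM.
    by rewrite mulrA mulrN; apply: OKM => //; apply: OKN.
  have Cy' : cosets (Mset 1) (coset y) by exists y.
  exists (coset y) => //=.
  have /cosetP[e [b [ue Ob' ->]]] := xget_coset y; rewrite Lact.
  have -> : coset (act e (al * b) (L y)) = coset (L y).
    by apply/coset_eq/cosetP; exists e, (al * b); split=> //; rewrite mulrCA; apply: OKM.
  apply/coset_eq/cosetP; exists 1, (- (ma g * b0 + mb g * d0)); split; first exact: unitO1.
    by rewrite mulrN mulrDr; apply/OKN/OKD; [rewrite mulrCA | rewrite mulrA]; apply: OKM.
  have [A B C' D] := actE 1 (- (ma g * b0 + mb g * d0)) g; have [A2 B2 C2 D2] := LE y.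
  apply: mat_ext; rewrite ?A ?B ?C' ?D ?A2 ?B2 ?C2 ?D2 ?Ay ?By ?Cy ?Dy ?mul1r //.
    transitivity (d0 * dt g); first by field.
    by rewrite -[X in X + _]mulr1 E1 /dt; ring.
  transitivity (- b0 * dt g); first by field.
  by rewrite -[X in X + _]mulr1 E1 /dt; ring.
Qed.

(** Bottom rows here are divisible by d (the left entry by t d), so translations by (dt)^-1 O
    preserve this part of M_al, not only those by t^-1 O. They commute with ZN, hence permute the
    cosets. *)
Lemma csum_translation_eq0 al mu z d : OK al -> totpos sigma al -> c mu -> totpos sigma mu ->
  upper_half_n z -> d != 0 -> ~ OK (mu / (q * d)) ->
  csum (cosets [set g | Mset al g /\ bottom_ideal g = principal d]) (tm mu z) = 0.
Proof.
move=> Oal alp cmu mup hz d0 ndiv; have al0 := totpos_neq0 alp.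
(* If Tr(mu x) were integral for all x in (dt)^-1 O, then mu/(dt) would lie in the codifferent (x0),
   that is, mu/(qd) in O. *)
have [x Ox xZ] : exists2 x, OK (d * t * x) & forall m : int, trF sigma (mu * x) <> m%:~R.
  apply: contrapT => h; apply: ndiv.
  suff : codifferent sigma (mu / (d * t)).
    rewrite codE principalP // => O1; rewrite (_ : mu / (q * d) = mu / (d * t) / x0) //.
    by rewrite /t; field; rewrite d0 x00 q0.
  move=> y Oy; apply: contrapT => hy; apply: h; exists (y / (d * t)).
    by rewrite mulrC divfK // mulf_neq0.
  by move=> m; rewrite mulrCA mulrC => E; apply: hy; exists m; rewrite -E; congr trF; ring.
set R := [set g | _].
have stable x' g : OK (d * t * x') -> R g -> R (act 1 x' g).
  move=> Ox' [Mg Ig]; have [d' [_ _ _ _ _]] := bottom_ideal_principal Oal al0 Mg.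
  have mem y : bottom_ideal g y -> OK (y / d) by rewrite Ig principalP.
  have O1 : OK (md g / d).
    by apply: mem; exists 0, 1; split; rewrite ?mulr0 ?mulr1 ?add0r //; [exact: OK0 | exact: OK1].
  have O2 : OK (mc g / t / d).
    apply: mem; exists t^-1, 0; split; last by rewrite mulr0 addr0.
      by rewrite mulfV //; apply: OK1.
    exact: OK0.
  split; last by rewrite bottom_ideal_act //; apply: unitO1.
  case: Mg => Oa Od Ob Oc ug; rewrite /Mset /= dt_act expr1n mul1r.
  case: (actE 1 x' g) => -> -> -> ->; rewrite !mul1r; split=> //.
    by apply: OKD => //; rewrite (_ : _ * _ = (d * t * x') * (mc g / t / d)); [exact: OKM | field; rewrite d0].
  rewrite mulrDr; apply: OKD => //.
  by rewrite (_ : _ * _ = (d * t * x') * (md g / d)); [exact: OKM | field].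
have Linj : injective (@act F 1 x).
  by move=> m m' /(congr1 (act 1 (- x))); rewrite !act_act mulr1 addNr !act_id.
have Lc g : coset (act 1 x g) = act 1 x @` coset g.
  apply/seteqP; split=> m.
    move=> /cosetP[e [b [ue Ob ->]]]; exists (act e b g); first by apply/cosetP; exists e, b.
    by rewrite !act_act mulr1 mul1r addrC.
  move=> [_ /cosetP[e [b [ue Ob ->]]] <-]; apply/cosetP; exists e, b; split=> //.
  by rewrite !act_act mulr1 mul1r addrC.
have RL : R = act 1 x @` R.
  apply/seteqP; split=> g; last by move=> [g' Rg' <-]; apply: stable.
  move=> Rg; exists (act 1 (- x) g); last by rewrite act_act mulr1 subrr act_id.
  by apply: stable => //; rewrite mulrN; apply: OKN.
have sumR : csummable (cosets R) (tm mu z).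
  by apply: csummable_sub (summable_tm Oal alp cmu mup hz) => S [g [Mg _] ->]; exists g.
have E : csum (cosets R) (tm mu z) = etr sigma (mu * x) * csum (cosets R) (tm mu z).
  rewrite {1}(csum_reindex _ (image_cosets_bij Linj Lc RL)) -csumZ //.
  apply: eq_csum => _ [g Rg ->]; have g0 := Mset_dt0 alp Rg.1.
  rewrite /= -Lc !tm_coset //; last by rewrite dt_act expr1n mul1r.
  by rewrite term_act //; apply: unitO1.
apply/eqP; apply: contrapT => /negP s0.
have : etr sigma (mu * x) = 1 by apply: (mulIf s0); rewrite -E mul1r.
by move=> /cexp_2pi_eq1[m] /xZ.
Qed.

(** The assumption says that common divisors of al and mu/q are units. A non-primitive bottom ideal
    has a non-unit generator dividing al, so it cannot divide mu/q and its part vanishes. *)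
Lemma poincare_zero_mul al mu : OK al -> totpos sigma al -> c mu -> totpos sigma mu ->
  (forall d, OK d -> d != 0 -> OK (al / d) -> OK (mu / (q * d)) -> OK d^-1) ->
  poincare_zero sigma k c nn mu -> poincare_zero sigma k c nn (mu * al).
Proof.
move=> Oal alp cmu mup cop P0 z hz; have al0 := totpos_neq0 alp.
have sM := summable_tm Oal alp cmu mup hz.
have := hecke_eq0 Oal alp cmu mup hz P0.
rewrite (csum_split [set S | bot S = @OK F] sM) (cosets_bot (Mset al) (fun I => I = @OK F)) csum_prim //.
rewrite (_ : csum (_ `&` ~` _) _ = 0) ?addr0 //.
apply: (csum_fibers_eq0 (p := bot)); first by apply: csummable_sub sM => S [].
move=> _ [_ [[g Mg ->] nb] <-]; rewrite /= bot_coset in nb; rewrite bot_coset.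
have [d [d0 Od Oald _ Id]] := bottom_ideal_principal Oal al0 Mg.
rewrite (_ : _ `&` _ = cosets [set g | Mset al g /\ bottom_ideal g = principal d]).
  apply: csum_translation_eq0 => // Omu; apply: nb; rewrite Id.
  by apply: principal_unit => //; apply: cop.
rewrite -(cosets_bot _ (fun I => I = principal d)) Id; apply/seteqP; split=> S.
  by move=> [[? _] ?].
by move=> [? E]; split=> //; split=> //; rewrite /= (E : bot S = _) -Id.
Qed.

(** * Determinant a prime element *)

Section Prime.
Variable p : F.
Hypotheses (pp : totpos sigma p) (p_prime : prime_elt p).
Hypothesis p_cop : exists x y, [/\ OK x, OK y & p * x + v * y = 1].

Let p0 : p != 0. Proof. exact: totpos_neq0. Qed.
Let Op : OK p. Proof. by case: p_prime. Qed.
Let p_nunit : ~ OK p^-1.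
Proof.
case: p_prime => _ _ /eqP np _ Op'; apply: np; exact: principal_unit.
Qed.

Let L g := mk 1 0 0 p *m g.

Let LE g : [/\ ma (L g) = ma g, mb (L g) = mb g, mc (L g) = p * mc g & md (L g) = p * md g].
Proof.
have [A B C' D] := mulmE (mk 1 0 0 p) g; have [a b c' d] := mkE 1 0 0 p.
by rewrite /L A B C' D a b c' d !mul0r !mul1r !add0r !addr0.
Qed.

Let L_act g e b : L (act e (p * b) g) = act e b (L g).
Proof.
have [A B C' D] := LE g; have [A1 B1 C1 D1] := LE (act e (p * b) g).
have [A2 B2 C2 D2] := actE e (p * b) g; have [A3 B3 C3 D3] := actE e b (L g).
by apply: mat_ext; rewrite ?A1 ?B1 ?C1 ?D1 ?A2 ?B2 ?C2 ?D2 ?A3 ?B3 ?C3 ?D3 ?A ?B ?C' ?D; ring.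
Qed.

Let dtL g : dt (L g) = p * dt g.
Proof. by rewrite /dt; case: (LE g) => -> -> -> ->; ring. Qed.

(* Coprimality of p and the level is what keeps mc g / p in the level ideal. *)
Lemma nonprimitive_prime g : (Mset p g /\ bottom_ideal g <> @OK F) <-> exists2 y, Mset 1 y & g = L y.
Proof.
split=> [[Mg nI]|[y My ->]].
  have [d [d0 Od Opd [Oc Od'] Id]] := bottom_ideal_principal Op p0 Mg.
  have nd : ~ OK d^-1 by move=> Odi; apply: nI; rewrite Id; apply: principal_unit.
  (* The prime p divides d * (p / d); dividing p / d would make d a unit, so p divides d and with it
     the bottom row. *)
  have Odp : OK (d / p).
    have [_ _ _ /(_ d (p / d) Od Opd)] := p_prime; case.
    - by exists 1; [exact: OK1 | rewrite mulr1 mulrC divfK].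
    - by rewrite principalP.
    - rewrite principalP // => h; case: nd; rewrite (_ : d^-1 = p / d / p) //; field.
      by rewrite d0 p0.
  have Ocp : OK (mc g / (t * p)).
    by rewrite (_ : _ / _ = mc g / (t * d) * (d / p)); [exact: OKM | field; rewrite d0 p0].
  have Odgp : OK (md g / p).
    by rewrite (_ : _ / _ = md g / d * (d / p)); [exact: OKM | field; rewrite d0 p0].
  have [Oa Odg Ob Ocv ug] := Mg.
  have [x [y [Ox Oy pv]]] := p_cop.
  have [A B C' D] := mkE (ma g) (mb g) (mc g / p) (md g / p).
  exists (mk (ma g) (mb g) (mc g / p) (md g / p)).
    have dty : dt (mk (ma g) (mb g) (mc g / p) (md g / p)) = dt g / p.
      by rewrite /dt A B C' D; ring.
    rewrite /Mset /= dty A B C' D divr1; split=> //.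
      have -> : mc g / p / (t * v) = (p * x + v * y) * (mc g / p / (t * v)) by rewrite pv mul1r.
      rewrite (_ : _ * _ = x * (mc g / (t * v)) + y * (mc g / (t * p))).
        by apply: OKD; apply: OKM.
      by field; rewrite p0 v0 t0.
  have [A1 B1 C1 D1] := LE (mk (ma g) (mb g) (mc g / p) (md g / p)).
  by apply: mat_ext; rewrite ?A1 ?B1 ?C1 ?D1 ?A ?B ?C' ?D // mulrC divfK.
split.
  case: My => Oa Od Ob Oc; rewrite divr1 => uy; rewrite /Mset /= dtL.
  have -> : p * dt y / p = dt y by rewrite mulrAC mulfV // mul1r.
  by case: (LE y) => -> -> -> ->; split=> //; [exact: OKM | rewrite -mulrA; exact: OKM].
move=> I1; apply: p_nunit; have : bottom_ideal (L y) 1 by rewrite I1; apply: OK1.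
move=> [b [w [Ob Ow]]]; case: (LE y) => _ _ -> -> E.
rewrite (_ : p^-1 = mc y / t * (t * b) + md y * w).
  have Oct := Mset_mct My; case: My => _ Ody _ _ _.
  by apply: OKD; apply: OKM.
by apply: (mulfI p0); rewrite mulfV // {1}E; field.
Qed.

(** [r] depends only on the class modulo p, because it picks from the set of all bounded elements of
    that class. Its image is finite since on bounded elements 1 is dominated by a multiple of the
    summable weight. *)
Lemma residue_system : exists r : F -> F,
  [/\ forall x, OK x -> OK (r x) /\ OK ((x - r x) / p),
      forall x y, OK x -> OK ((x - y) / p) -> r x = r y &
      (\esum_(j in r @` @OK F) (1%R : RR)%:E < +oo)%E].
Proof.
have [BR BR0 HR] := residue_reps sigma Op p0.
pose cl x : set F := [set y | [/\ OK y, OK ((x - y) / p) & forall i, `|sigma i y| <= BR]].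
have clr x : OK x -> cl x (xget 0 (cl x)).
  move=> Ox; have [y Oy yB] := HR x Ox; apply: xgetPex; exists (x - p * y).
  split=> //; first by apply: OKB => //; apply: OKM.
  by rewrite opprB addrC subrK mulrC mulKf.
pose r x := xget 0 (cl x); exists r; split.
- by move=> x /clr[].
- move=> x y Ox Oxy; rewrite /r; congr xget; apply/seteqP; split=> w [Ow Oxw wB]; split=> //.
    by rewrite (_ : (y - w) / p = (x - w) / p - (x - y) / p); [exact: OKB | ring].
  by rewrite (_ : (x - w) / p = (y - w) / p + (x - y) / p); [exact: OKD | ring].
pose K : RR := (1 + BR ^+ 2) ^+ n; have K0 : 0 <= K by rewrite exprn_ge0 // addr_ge0 ?sqr_ge0.
apply: (@le_lt_trans _ _ (\esum_(j in @OK F) (K%:E * (wt sigma j)%:E))%E).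
  apply: (@le_trans _ _ (\esum_(j in r @` @OK F) (K%:E * (wt sigma j)%:E))%E).
    apply: le_esum => _ [x Ox <-]; rewrite -EFinM lee_fin; apply: wt_lower_bound.
    by case: (clr x Ox).
  by apply: esum_sub => _ [x Ox <-]; case: (clr x Ox).
rewrite esumZl //; last by move=> x _; rewrite lee_fin wt_ge0.
by rewrite lte_mul_pinfty ?lee_fin //; apply: esum_wt.
Qed.

(** K = |O/p| N(p)^-k. Multiplication by diag(1, p) turns translation by p b into translation by b,
    so one coset of Gamma spreads over |O/p| cosets, indexed by translations j/t with j modulo p.
    Their terms coincide, as mu/p lies in c. *)
Lemma csum_nonprimitive mu z : c mu -> c (mu / p) -> totpos sigma mu -> upper_half_n z ->
  exists2 K : C, K != 0 &
    csum (cosets [set g | Mset p g /\ bottom_ideal g <> @OK F]) (tm mu z) =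
    K * poincare sigma k c nn (mu / p) z.
Proof.
move=> cmu cmup mup hz; have [r [rO rE rfin]] := residue_system.
have mupp : totpos sigma (mu / p) by move=> i; rewrite rmorphM fmorphV mulr_gt0 ?invr_gt0.
have p1 := (unitO_pos1 sigma).2.
have sM1 := summable_tm (OK1 F) p1 cmup mupp hz.
pose J := r @` @OK F.
have mJ : 1 <= fine (\esum_(j in J) (1%R : RR)%:E)%E.
  rewrite -lee_fin fineK; last by rewrite ge0_fin_numE // esum_ge0.
  apply: (@le_trans _ _ (\esum_(j in [set r 0%R]) (1%R : RR)%:E)%E); first by rewrite esum_set1.
  by apply: esum_sub => _ ->; exists 0 => //; apply: OK0.
pose N : C := (Complex (nrF sigma p) 0) ^- k.
exists (Complex (fine (\esum_(j in J) (1%R : RR)%:E)%E) 0 * N).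
  rewrite mulf_neq0 //.
    by rewrite eq_complex /= eqxx andbT gt_eqF // (lt_le_trans ltr01).
  rewrite invr_eq0 expf_neq0 // eq_complex /= eqxx andbT.
  by apply/prodf_neq0 => i _; rewrite fmorph_eq0.
pose h (x : set 'M[F]_2 * F) := coset (L (act 1 (x.2 / t) (xget 0 x.1))).
have M1x S : cosets (Mset 1) S -> Mset 1 (xget 0 S) /\ S = coset (xget 0 S).
  move=> [g Mg ->]; have hg := xget_coset g; rewrite (coset_eq hg); split=> //.
  by move/cosetP: hg => [e [b [ue Ob ->]]]; apply: Mset_act.
have JO j : J j -> OK j by move=> [x /rO[Orx _] <-].
have tj j : t * (j / t) = j by rewrite mulrC divfK.
have Mj g j : J j -> Mset 1 g -> Mset 1 (act 1 (j / t) g).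
  by move=> /JO Oj Mg; apply: Mset_act => //; [exact: unitO1 | rewrite tj].
have MLp g : Mset 1 g -> Mset p (L g) /\ bottom_ideal (L g) <> @OK F.
  by move=> Mg; apply/nonprimitive_prime; exists g.
rewrite (@csum_reindex _ _ (cosets (Mset 1) `*` J) _ h); last first.
  split.
  - move=> [S j] [/M1x[Mg _] Jj]; exists (L (act 1 (j / t) (xget 0 S))) => //.
    exact/MLp/Mj.
  - move=> [S j] [S' j']; rewrite !inE => -[/= /M1x[Mg ES] Jj] [/= /M1x[Mg' ES'] Jj'] E.
    have : coset (L (act 1 (j / t) (xget 0 S))) (L (act 1 (j' / t) (xget 0 S'))).
      by rewrite [coset _]E; apply: coset_refl.
    move=> /cosetP[e [b [ue Ob]]]; rewrite -L_act act_act mulr1 => El.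
    pose b' := p * b + j / t - j' / t.
    have E' : xget 0 S' = act e b' (xget 0 S).
      have Linj g g' : L g = L g' -> g = g'.
        move=> Eg; have [A B C' D] := LE g; have [A1 B1 C1 D1] := LE g'.
        by apply: mat_ext; [rewrite -A -A1 | rewrite -B -B1 | apply: (mulfI p0); rewrite -C' -C1
          | apply: (mulfI p0); rewrite -D -D1]; rewrite Eg.
      rewrite -[LHS]act_id -(subrr (j' / t)) -{1}[1]mulr1.
      rewrite addrC -(act_act 1 (- (j' / t))) (Linj _ _ El) act_act mul1r.
      by congr act; rewrite /b' addrC.
    have Ob' : OK (t * b').
      rewrite (_ : t * b' = p * (t * b) + (j - j')); first by apply: OKD; [exact: OKM | exact/OKB/JO/Jj'/JO].
      by rewrite /b'; field.
    have ESS : S = S'.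
      by rewrite ES ES' E'; apply/esym/coset_eq/cosetP; exists e, b'.
    rewrite -ESS; congr pair; rewrite -ESS in E'.
    have g0 := Mset_dt0 p1 Mg; have [A B C' D] := actE e b' (xget 0 S).
    (* The element of ZN given by e and b' fixes a matrix of nonzero determinant, so it is trivial;
       then j and j' are congruent modulo p. *)
    have e1 : e = 1.
      case/orP: (dt_neq0_row g0) => nz; apply: (mulIf nz); rewrite mul1r.
        by rewrite -C' -E'.
      by rewrite -D -E'.
    have b'0 : b' = 0.
      have [Ea Eb] : ma (xget 0 S) = ma (xget 0 S) + b' * mc (xget 0 S) /\
                     mb (xget 0 S) = mb (xget 0 S) + b' * md (xget 0 S).
        by split; rewrite -[RHS]mul1r -{1}e1 -?A -?B -E'.
      case/orP: (dt_neq0_row g0) => nz; apply: (mulIf nz); rewrite mul0r.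
        by apply: (addrI (ma (xget 0 S))); rewrite -Ea addr0.
      by apply: (addrI (mb (xget 0 S))); rewrite -Eb addr0.
    have jj : (j' - j) / p = t * b.
      have /(congr1 (fun x => t * x)) := b'0; rewrite mulr0 => Eb.
      apply: (mulIf p0); rewrite divfK //.
      have <- : j' - j + t * b' = t * b * p by rewrite /b'; field.
      by rewrite Eb addr0.
    case: Jj Jj' jj => x Ox <- [y Oy <-] jj.
    have [Orx Oxr] := rO _ Ox; have [Ory Oyr] := rO _ Oy.
    apply: (rE) => //.
    rewrite (_ : (x - y) / p = (x - r x) / p - (y - r y) / p - (r y - r x) / p); last by ring.
    by rewrite jj; apply: OKB => //; apply: OKB.
  - move=> _ [g /nonprimitive_prime[y My ->] ->].
    have Cy : cosets (Mset 1) (coset y) by exists y.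
    have [Mg Eg] := M1x _ Cy; pose g1 := xget 0 (coset y).
    have : coset g1 y by rewrite -Eg; apply: coset_refl.
    move=> /cosetP[e [b [ue Ob Ey]]]; have [Or Obr] := rO _ Ob.
    exists (coset y, r (t * b)); first by split=> //; exists (t * b).
    (* Subtracting the representative of t b modulo p leaves p times an element of the translation
       lattice, which passes through diag(1, p). *)
    pose b1 := (b - r (t * b) / t) / p.
    apply/esym/coset_eq/cosetP; exists e, b1; split=> //.
      by rewrite (_ : t * b1 = (t * b - r (t * b)) / p) // /b1; field; rewrite p0.
    rewrite -L_act act_act mulr1 -/g1 [in LHS]Ey; congr (L (act _ _ _)).
    by rewrite /b1 /=; field; rewrite p0 t0.
rewrite poincareE -mulrA -csumZ // -csum_prod //; last exact: csummableZ.
apply: eq_csum => -[S j] [/= /M1x[Mg _] Jj].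
have MLj := (MLp _ (Mj _ _ Jj Mg)).1.
rewrite /h /= tm_coset ?(Mset_dt0 pp MLj) // /L term_diagr // /tm; congr (_ * _).
have g0 := Mset_dt0 p1 Mg.
rewrite term_act //; last exact: unitO1.
by rewrite etr_int // ?mul1r // tj; apply: JO.
Qed.

End Prime.

(** * Descent along powers of p, and the theorem *)

Lemma poincare_zero_descent (p mu : F) : totpos sigma p -> prime_elt p ->
  (exists x y, [/\ OK x, OK y & p * x + v * y = 1]) ->
  c mu -> c (mu / p) -> totpos sigma mu ->
  poincare_zero sigma k c nn mu -> poincare_zero sigma k c nn (mu * p) ->
  poincare_zero sigma k c nn (mu / p).
Proof.
move=> pp pprime pcop cmu cmup mup Z Zp z hz; have Op : OK p by case: pprime.
have sM := summable_tm Op pp cmu mup hz.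
have [K K0 E] := csum_nonprimitive pp pprime pcop cmu cmup mup hz.
have := hecke_eq0 Op pp cmu mup hz Z.
rewrite (csum_split [set S | bot S = @OK F] sM).
rewrite (cosets_bot (Mset p) (fun I => I = @OK F)) (cosets_bot (Mset p) (fun I => I <> @OK F)).
by rewrite csum_prim // Zp // add0r E => /eqP; rewrite mulf_eq0 (negPf K0) => /eqP.
Qed.

End Hecke.
Theorem theorem4p5 (n : nat) (F : fieldExtType rat)
  (sigma : 'I_n -> {rmorphism F -> RR}) :
  (1 < n)%N -> \dim {:F} = n -> injective sigma ->
  narrow_class_number_one sigma ->
  forall (k : nat) (nn c : set F) (q mu : F),
  (2 < k)%N -> ~~ odd k ->
  int_ideal nn ->
  totpos sigma q -> c = principal q ->
  c mu -> totpos sigma mu ->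
  (* (1) *)
  (forall alpha : F, OK alpha -> totpos sigma alpha ->
     coprime_ideals (principal alpha) (ideal_mul (principal (mu / q)) nn) ->
     poincare_zero sigma k c nn mu -> poincare_zero sigma k c nn (mu * alpha))
  /\
  (* (2) *)
  (forall (p : F) (m : nat), totpos sigma p -> prime_elt p ->
     coprime_ideals (principal p) (ideal_mul (principal (mu / q)) nn) ->
     (0 < m)%N ->
     ~ poincare_zero sigma k c nn mu ->
     ~ poincare_zero sigma k c nn (mu * p ^+ m) \/
     (~ poincare_zero sigma k c nn (mu * p ^+ m.-1) /\
      ~ poincare_zero sigma k c nn (mu * p ^+ m.+1))).
Proof.
move=> n1 dimF sinj narrow k nn c q mu k2 ke [fnn nnO] qp cE cmu mup.
have [v [vp nnE]] := narrow _ fnn.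
have [x0 [x0p codE]] := narrow _ (codifferent_frac_ideal n1 dimF sinj).
have q0 := totpos_neq0 n1 qp; have v0 := totpos_neq0 n1 vp.
have Ov : OK v by apply: nnO; rewrite nnE; exists 1; [exact: OK1 | rewrite mulr1].
have Omu : OK (mu / q) by rewrite cE in cmu; apply/principalP.
have cop al : coprime_ideals (principal al) (ideal_mul (principal (mu / q)) nn) ->
    exists x y, [/\ OK x, OK y & al * x + mu / q * v * y = 1].
  rewrite /coprime_ideals nnE principal_mul => E.
  have [_ [x Ox <-] [_ [y Oy <-] E1]] : ideal_add (principal al) (principal (mu / q * v)) 1.
    by rewrite E; apply: OK1.
  by exists x, y.
split=> [al Oal alp /cop[x [y [Ox Oy E]]]|p m pp pprime /cop[x [y [Ox Oy E]]] m0 nZ].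
  apply: (poincare_zero_mul n1 dimF sinj k2 ke qp x0p Ov v0 codE cE nnE narrow) => // d Od d0 Oad Omd.
  (* Bezout's relation between al and (mu/q) v, divided by a common divisor d of al and mu/q. *)
  have -> : d^-1 = al / d * x + mu / (q * d) * v * y.
    by apply: (mulfI d0); rewrite mulfV // -E; field; rewrite d0 q0.
  by apply: OKD; apply: OKM => //; apply: OKM.
have p0 := totpos_neq0 n1 pp; have Op : OK p by case: pprime.
pose Z j := poincare_zero sigma k c nn (mu * p ^+ j).
have OpX j : OK (p ^+ j).
  by elim: j => [|j IH]; [exact: OK1 | rewrite exprS; apply: OKM].
have cX j : c (mu * p ^+ j).
  by rewrite cE principalP // mulrAC; apply: OKM.
have pX j : totpos sigma (mu * p ^+ j).
  by move=> i; rewrite rmorphM rmorphXn mulr_gt0 ?exprn_gt0.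
have XE j : mu * p ^+ j = mu * p ^+ j.+1 / p by rewrite exprSr mulrA mulfK.
(* Two consecutive zeros propagate downwards: zeros at j+1 and j+2 give one at j, until the exponent
   0 is reached. *)
have down j : Z j -> Z j.+1 -> poincare_zero sigma k c nn mu.
  elim: j => [|j IH]; first by rewrite /Z expr0 mulr1.
  move=> Z1 Z2; apply: IH => //; rewrite /Z XE.
  apply: (poincare_zero_descent n1 dimF sinj k2 ke qp x0p Ov v0 codE cE nnE narrow) => //.
  - by exists x, (mu / q * y); split; [| exact: OKM | rewrite -E; ring].
  - by rewrite -XE.
  - by rewrite -mulrA -exprSr.
(* If the series at p^m vanishes, a zero at either neighbouring exponent would complete a
   consecutive pair and force the series at mu to vanish. *)
have [Zm|] := pselect (Z m); last by left.
right; split=> Zj; apply: nZ; last exact: down Zm Zj.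
by apply: (down m.-1) => //; rewrite prednK.
Qed.
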